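(* Up to mirror images, the only PL-virtual knots realizable with five or fewer edges are the unknot and the virtual knots $2.1$, $3.5$ and $3.7$ of the virtual knot table.
   Context: A virtual knot diagram is a generically immersed closed curve in the plane each of whose double points is either a real (classical) crossing, carrying over/under information, or a virtual crossing, carrying none. A virtual knot is an equivalence class of virtual knot diagrams under the classical Reidemeister moves together with the generalized (virtual) Reidemeister moves (the virtual versions of moves I, II, III, and the mixed move sliding a strand with two virtual crossings past a real crossing). A PL-virtual knot with $n$ edges is given by an ordered $n$-tuple of points $v_1,\dots,v_n$ in $\mathbb{R}^3$, joined cyclically by straight segments (edges), such that: $v_i\neq v_j$ for $i\neq j$; no $v_i$ lies on the segment between $v_j$ and $v_k$ for $i\ne j$, $i\neq k$; and no two distinct edges partially overlap or meet at a point other than a vertex. The polygon is projected to a plane in general position, and each crossing of the projections of two nonadjacent edges is either a real crossing, with over/under information determined by the position of the edges in space, or is declared to be a virtual crossing. A knot is realizable with $n$ edges if some such $n$-edged polygon, with some choice of which crossings are virtual, has a diagram representing it. The unknot is included among the PL-virtual knots considered in this statement. A virtual knot diagram has two mirror images: the horizontal mirror image, obtained by reflecting the diagram in a mirror, and the vertical mirror image, obtained by switching over- and undercrossing strands at all real crossings. ''Up to mirror images'' means up to these operations. The names $2.1$, $3.5$, $3.7$ refer to Jeremy Green's table of virtual knots (in $m.k$, $m$ is the minimal number of real crossings). Up to mirror images they are given by the following signed Gauss codes (O = over, U = under, followed by the crossing label and the sign of the crossing): $2.1$: O1$-$O2$-$U1$-$U2$-$; $3.5$: O1$-$O2$-$O3$-$U1$-$U2$-$U3$-$;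 $3.7$: O1$-$U2$-$O3$+$U1$-$O2$-$U3$+$.
   Formalization: That 3.7 is realizable is not asserted, as it is false under the stated conventions. Stated: up to mirror images only the unknot, 2.1, 3.5 and 3.7 can occur with five or fewer edges, and the unknot, 2.1, 3.5 and their mirror images do occur. *)

(* Defs.v *)
From HB Require Import structures.
From Stdlib Require Import Relation_Operators.
From mathcomp Require Import all_boot all_order all_algebra.
From mathcomp Require Import reals.

Set Implicit Arguments.
Unset Strict Implicit.
Unset Printing Implicit Defensive.

Import Order.TTheory GRing.Theory Num.Theory.

Inductive strand := Over | Under | Virt.

Definition strand_eqb (s t : strand) : bool :=
  match s, t with
  | Over, Over | Under, Under | Virt, Virt => true
  | _, _ => false
  end.

Lemma strand_eqP : Equality.axiom strand_eqb.
Proof. by case; case; constructor. Qed.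

HB.instance Definition _ := hasDecEq.Build strand strand_eqP.

(* A passage of the travelling point through a double point of the curve.
   [side] is true iff the other strand crosses from right to left as seen from
   this passage; a double point is passed twice, with opposite sides. *)
Definition passage : Type := (nat * strand * bool)%type.
Definition label (e : passage) : nat := e.1.1.
Definition kind (e : passage) : strand := e.1.2.
Definition side (e : passage) : bool := e.2.

Definition opposite (s : strand) : strand :=
  match s with Over => Under | Under => Over | Virt => Virt end.

Definition partner (e : passage) : passage :=
  (label e, opposite (kind e), ~~ side e).

(* A generic closed curve in the plane, with marked double points, up to planar
   isotopy.  It is traversed from a base point chosen on the boundary of the
   unbounded face (and distinct from the double points); [code] lists the
   passages in that order, real and virtual ones alike, and [outer_left] tells
   whether the unbounded face is to the left of the curve at the base point.
   The choice of base point and of direction is undone by the constructors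
   [rebase] and [reverse] of [move] below. *)
Record diagram := Diagram { outer_left : bool; code : seq passage }.

Definition well_formed (w : seq passage) : bool :=
  all (fun e => (count (fun f => label f == label e) w == 2)
                && (partner e \in w)) w.

(* Arc i of the curve runs from passage i to passage i+1 (cyclically); the
   last arc contains the base point.  The dart (i, d) is arc i traversed
   forwards (d = true) or backwards (d = false).  [next_dart] turns left at the
   end of the dart, so that its cycles are the boundaries of the faces of the
   curve, each face lying to the left of its darts. *)
Definition dart : Type := (nat * bool)%type.

Definition next_dart (w : seq passage) (a : dart) : dart :=
  let n := size w in
  let e := nth (0, Virt, false) w (if a.2 then a.1.+1 %% n else a.1) in
  let k := index (partner e) w in
  if side e == a.2 then (k, true) else ((k + n.-1) %% n, false).

Definition darts (w : seq passage) : seq dart :=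
  [seq (i, d) | i <- iota 0 (size w), d <- [:: true; false]].

Definition is_face (w : seq passage) (c : seq dart) : bool :=
  [&& c != [::], uniq c & fcycle (next_dart w) c].

(* A code comes from a curve in the plane iff its surface has genus 0, that is
   V + F = E + 2 with V = size w / 2 double points and E = size w arcs.  A
   curve without double points has no arc and is treated apart. *)
Definition planar (w : seq passage) : Prop :=
  w = [::] \/
  exists fs : seq (seq dart),
    [/\ all (is_face w) fs, perm_eq (flatten fs) (darts w)
      & (size w)./2 + size fs = size w + 2].

Definition plane_diagram (D : diagram) : Prop :=
  well_formed (code D) /\ planar (code D).

Definition bounds_face (w : seq passage) (arcs : seq nat) : Prop :=
  exists2 c : seq dart, is_face w c & perm_eq [seq a.1 | a <- c] arcs.

(* The first three constructors relate codes of one and the same curve; the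
   others are the Reidemeister moves.  A monogon, bigon or triangle made of
   arcs other than the last one is never the unbounded face. *)
Inductive move : diagram -> diagram -> Prop :=
| relabel o w (f : nat -> nat) :
    injective f ->
    move (Diagram o w) (Diagram o [seq (f (label e), kind e, side e) | e <- w])
| rebase o w j d c :
    j < size w -> is_face w c -> ((size w).-1, o) \in c -> (j, d) \in c ->
    move (Diagram o w) (Diagram d (rot j.+1 w))
| reverse o w :
    move (Diagram o w) (Diagram (~~ o) (rev w))
(* classical and virtual move I *)
| move1 o x p q y :
    bounds_face (x ++ [:: p; q] ++ y) [:: size x] ->
    move (Diagram o (x ++ [:: p; q] ++ y)) (Diagram o (x ++ y))
(* classical move II (one strand over, the other one under) and virtual move
   II (both double points virtual) *)
| move2 o x p1 q1 y p2 q2 z :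
    bounds_face (x ++ [:: p1; q1] ++ y ++ [:: p2; q2] ++ z)
      [:: size x; size (x ++ [:: p1; q1] ++ y)] ->
    kind p1 = kind q1 ->
    move (Diagram o (x ++ [:: p1; q1] ++ y ++ [:: p2; q2] ++ z))
         (Diagram o (x ++ y ++ z))
(* Classical move III (some strand is over the two others, some strand is
   under the two others); virtual move III and mixed move (some strand has two
   virtual double points, the third double point being virtual or real). *)
| move3 o x p1 q1 y p2 q2 z p3 q3 t :
    bounds_face
      (x ++ [:: p1; q1] ++ y ++ [:: p2; q2] ++ z ++ [:: p3; q3] ++ t)
      [:: size x; size (x ++ [:: p1; q1] ++ y);
          size (x ++ [:: p1; q1] ++ y ++ [:: p2; q2] ++ z)] ->
    (let ks := [:: (kind p1, kind q1); (kind p2, kind q2);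
                   (kind p3, kind q3)] in
     ((Virt, Virt) \in ks)
     || (((Over, Over) \in ks) && ((Under, Under) \in ks))) ->
    move
      (Diagram o
        (x ++ [:: p1; q1] ++ y ++ [:: p2; q2] ++ z ++ [:: p3; q3] ++ t))
      (Diagram o
        (x ++ [:: q1; p1] ++ y ++ [:: q2; p2] ++ z ++ [:: q3; p3] ++ t)).

Definition virtually_equivalent : diagram -> diagram -> Prop :=
  clos_refl_sym_trans diagram
    (fun D D' => [/\ plane_diagram D, plane_diagram D' & move D D']).

Definition horizontal_mirror (D : diagram) : diagram :=
  Diagram (~~ outer_left D)
    [seq (label e, kind e, ~~ side e) | e <- code D].

Definition vertical_mirror (D : diagram) : diagram :=
  Diagram (outer_left D)
    [seq (label e, opposite (kind e), side e) | e <- code D].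

Definition up_to_mirror_images (P : diagram -> Prop) (D : diagram) : Prop :=
  [\/ P D, P (horizontal_mirror D), P (vertical_mirror D)
    | P (horizontal_mirror (vertical_mirror D))].

(* The signed Gauss code forgets the virtual crossings.  A crossing is positive
   iff the under strand crosses the over strand from right to left. *)
Definition sign (e : passage) : bool := side e == (kind e == Over).

Definition gauss_code (D : diagram) : seq (strand * nat * bool) :=
  [seq (kind e, label e, sign e) | e <- code D & kind e != Virt].

Definition is_unknot (D : diagram) : Prop :=
  exists o : bool, virtually_equivalent D (Diagram o [::]).

(* A virtual knot is determined by its Gauss code; each knot of the table is
   given here by one diagram having the tabulated code. *)
Definition knot_2_1 : diagram := Diagram false
  [:: (1, Over, false); (3, Virt, true); (2, Over, false);
      (1, Under, true); (3, Virt, false); (2, Under, true)].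

Definition knot_3_5 : diagram := Diagram false
  [:: (1, Over, false); (4, Virt, true); (2, Over, false); (5, Virt, true);
      (3, Over, false); (1, Under, true); (4, Virt, false); (2, Under, true);
      (5, Virt, false); (3, Under, true)].

Definition knot_3_7 : diagram := Diagram false
  [:: (1, Over, false); (2, Under, true); (4, Virt, false); (3, Over, true);
      (5, Virt, false); (1, Under, true); (2, Over, false); (4, Virt, true);
      (3, Under, false); (5, Virt, true)].

Local Notation "'O+' k" := (Over, k, true) (at level 8, k at level 7).
Local Notation "'O-' k" := (Over, k, false) (at level 8, k at level 7).
Local Notation "'U+' k" := (Under, k, true) (at level 8, k at level 7).
Local Notation "'U-' k" := (Under, k, false) (at level 8, k at level 7).

Fact gauss_code_2_1 : gauss_code knot_2_1 = [:: O- 1; O- 2; U- 1; U- 2].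
Proof. by []. Qed.

Fact gauss_code_3_5 :
  gauss_code knot_3_5 = [:: O- 1; O- 2; O- 3; U- 1; U- 2; U- 3].
Proof. by []. Qed.

Fact gauss_code_3_7 :
  gauss_code knot_3_7 = [:: O- 1; U- 2; O+ 3; U- 1; O- 2; U+ 3].
Proof. by []. Qed.

Fact plane_diagram_2_1 : plane_diagram knot_2_1.
Proof.
split=> //; right.
by exists
  [:: [:: (0, true); (4, true); (2, true)]; [:: (0, false); (3, true)];
      [:: (1, true); (4, false)]; [:: (1, false); (3, false); (5, false)];
      [:: (2, false); (5, true)]].
Qed.

Fact plane_diagram_3_5 : plane_diagram knot_3_5.
Proof.
split=> //; right.
by exists
  [:: [:: (0, true); (6, true); (2, true); (8, true); (4, true)];
      [:: (0, false); (5, true)]; [:: (1, true); (6, false)];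
      [:: (1, false); (5, false); (9, false); (3, false); (7, false)];
      [:: (2, false); (7, true)]; [:: (3, true); (8, false)];
      [:: (4, false); (9, true)]].
Qed.

Fact plane_diagram_3_7 : plane_diagram knot_3_7.
Proof.
split=> //; right.
by exists
  [:: [:: (0, true); (6, true); (2, true); (8, true); (4, true)];
      [:: (0, false); (5, true)]; [:: (1, true); (6, false)];
      [:: (1, false); (5, false); (9, false); (3, false); (7, false)];
      [:: (2, false); (7, true)]; [:: (3, true); (8, false)];
      [:: (4, false); (9, true)]].
Qed.

Local Open Scope ring_scope.

Definition lerp (R : realType) m (a b : 'rV[R]_m) (t : R) : 'rV[R]_m :=
  (1 - t) *: a + t *: b.

Definition on_segment (R : realType) m (a b p : 'rV[R]_m) : Prop :=
  exists2 t : R, 0 <= t <= 1 & p = lerp a b t.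

(* Edge i of a closed polygon joins vertex i to the cyclically next vertex. *)
Definition on_edge (R : realType) m n (v : n.-tuple 'rV[R]_m) (i : 'I_n)
    (p : 'rV[R]_m) : Prop :=
  on_segment (tnth v i) (tnth v (ordS i)) p.

Definition pl_polygon (R : realType) n (v : n.-tuple 'rV[R]_3) : Prop :=
  [/\ (3 <= n)%N,
      injective (tnth v),
      forall i j k : 'I_n, i != j -> i != k ->
        ~ on_segment (tnth v j) (tnth v k) (tnth v i)
    & forall i j : 'I_n, i != j -> forall p : 'rV[R]_3,
        on_edge v i p -> on_edge v j p -> exists k : 'I_n, p = tnth v k].

(* The columns of F form a positive orthonormal frame of R^3: two axes of the
   plane of projection and the axis pointing to the viewer. *)
Definition frame (R : realType) (F : 'M[R]_3) : Prop :=
  F *m F^T = 1%:M /\ \det F = 1.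

Definition proj (R : realType) (F : 'M[R]_3) (p : 'rV[R]_3) : 'rV[R]_2 :=
  lsubmx (p *m F : 'rV[R]_(2 + 1)).

Definition height (R : realType) (F : 'M[R]_3) (p : 'rV[R]_3) : R :=
  (p *m F) 0 ord_max.

Definition shadow (R : realType) n (F : 'M[R]_3) (v : n.-tuple 'rV[R]_3) :
    n.-tuple 'rV[R]_2 :=
  [tuple of map (proj F) v].

(* The closed polygon s is a generically immersed curve: no vertex lies on
   another edge than its two edges, and no three edges have a common point. *)
Definition general_position (R : realType) n (s : n.-tuple 'rV[R]_2) : Prop :=
  (forall i j : 'I_n, j != i -> j != ordS i -> ~ on_edge s i (tnth s j)) /\
  (forall i j k : 'I_n, uniq [:: i; j; k] ->
     ~ exists p, [/\ on_edge s i p, on_edge s j p & on_edge s k p]).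

(* The position (i, t) designates the point of parameter t on edge i. *)
Definition point_at (R : realType) m n (v : n.-tuple 'rV[R]_m)
    (a : 'I_n * R) : 'rV[R]_m :=
  lerp (tnth v a.1) (tnth v (ordS a.1)) a.2.

Definition direction (R : realType) m n (v : n.-tuple 'rV[R]_m) (i : 'I_n) :
    'rV[R]_m :=
  tnth v (ordS i) - tnth v i.

Definition before (R : realType) n (a b : 'I_n * R) : bool :=
  (a.1 < b.1)%N || (a.1 == b.1) && (a.2 < b.2).

Definition cross (R : realType) (u w : 'rV[R]_2) : R :=
  u 0 0 * w 0 1 - u 0 1 * w 0 0.

Definition dot (R : realType) m (u w : 'rV[R]_m) : R :=
  \sum_(i < m) u 0 i * w 0 i.

Definition crossing (R : realType) n (s : n.-tuple 'rV[R]_2)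
    (a b : 'I_n * R) : Prop :=
  [/\ a.1 != b.1, 0 < a.2 < 1, 0 < b.2 < 1 & point_at s a = point_at s b].

(* D is the diagram of the polygon v, viewed through F and based at its first
   vertex i0, for some choice of the virtual crossings.  For i0 to lie on the
   boundary of the unbounded face, it is required to be the unique farthest
   vertex in some direction u; the unbounded face is then to the left iff the
   polygon turns right at i0. *)
Definition diagram_of (R : realType) n (F : 'M[R]_3) (v : n.-tuple 'rV[R]_3)
    (D : diagram) : Prop :=
  let s := shadow F v in
  (exists ps : seq ('I_n * R),
     [/\ sorted (@before R n) ps,
         forall a, a \in ps <-> exists b, crossing s a b,
         size ps = size (code D)
       & forall a e b f,
           (a, e) \in zip ps (code D) -> (b, f) \in zip ps (code D) ->
           (label e = label f <-> a = b \/ crossing s a b) /\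
           (crossing s a b ->
              side e = (0 < cross (direction s a.1) (direction s b.1)) /\
              ((kind e = Virt /\ kind f = Virt) \/
               kind e = if height F (point_at v b) < height F (point_at v a)
                        then Over else Under))]) /\
  (exists i0 : 'I_n,
     [/\ val i0 = 0%N,
         exists u : 'rV[R]_2, forall i : 'I_n, i != i0 ->
           dot u (tnth s i) < dot u (tnth s i0)
       & outer_left D =
           (cross (direction s (ord_pred i0)) (direction s i0) < 0)]).

(* The rotation by b chooses the vertex at which the diagram is based. *)
Definition realizable (R : realType) (n : nat) (K : diagram) : Prop :=
  exists (v : n.-tuple 'rV[R]_3) (F : 'M[R]_3) (b : nat) (D : diagram),
    [/\ pl_polygon v, frame F, general_position (shadow F v),
        diagram_of F [tuple of rot b v] D & virtually_equivalent D K].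

(* Main.v *)
From HB Require Import structures.
From Stdlib Require Import Relation_Operators.
Require Import Defs.
From mathcomp Require Import all_boot all_order all_algebra.
From mathcomp Require Import reals zify ring lra.

Set Implicit Arguments.
Unset Strict Implicit.
Unset Printing Implicit Defensive.

(** The double points of the diagram of a polygon lie on pairs of edges without
common end.  A triangle or a quadrilateral has at most two such pairs, and a
plane diagram with at most two double points unwinds by the moves I and II
([few_crossings_unknot]).  So the matter is about pentagons, where the only
candidates are the crossings of the edges [k] and [k + 2], for [k] modulo 5.

The diagram of a pentagon can be read off from three families of signs
([pentagon_standard]): those of [turn k] and [skip k], which locate the vertices
[k + 2] and [k + 3] with respect to the edge [k] in the plane and thus say which
edges cross and from which side, and that of [volume k], the oriented volume of
the four vertices on the edges [k] and [k + 2] in space, which says which edge is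
above.  The order of the two crossings of an edge is left open; the Euler
characteristic decides it.

These signs are far from independent.  Five points in space satisfy one affine
relation, and its coefficients are the five volumes.  So the volumes have sum
zero, and the relation, measured by the distance to the line through two
vertices of the projection, gives a vanishing sum of three terms for each of the
ten pairs of vertices ([edge_signs], [diagonal_signs]).  Terms with sum zero have
both signs or none.  This is what excludes the trefoil, which has diagrams of the
right shape: a pentagon cannot cross itself with the over and under strands that
it requires.  With the relation between the areas of a quadrilateral
([area_signs]) and the position of the base vertex on the convex hull
([extreme_signs]), few sign patterns with three crossings or more remain.  For each of them, and each choice of virtual crossings, removing
monogons and bigons after suitable changes of base point leads to the unknot,
2.1, 3.5 or one of their mirror images.  This is checked by computation
([outcomes_okT]), with a simplification procedure proved sound
([reduces_to_sound]).

A diagram equivalent to a plane diagram is plane, so planarity of the diagram of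
the polygon comes from that of the given knot.  As mirror images are taken of the
given knot, equivalence must also be shown to be compatible with them
([equivalent_mirror]).

Conversely the vertices of a convex pentagon, joined as a pentagram, with suitable
heights and virtual crossings, represent the unknot, 2.1 and 3.5, and reflections
of this polygon represent their mirror images ([pentagram_realizable]). *)

(** * Faces of a code *)

Lemma partnerK : involutive partner.
Proof. by case=> [[l []] []]. Qed.

Lemma partner_neq e : partner e != e.
Proof.
case: e => [[l k] s]; apply/eqP => /(congr1 side); rewrite /partner /side /=.
by case: s.
Qed.

Definition dart_in (w : seq passage) (a : dart) : bool := a.1 < size w.

Lemma mem_darts w a : (a \in darts w) = dart_in w a.
Proof.
case: a => i d; rewrite /dart_in; apply/allpairsP/idP => /=.
  by case=> -[j e] [/=]; rewrite mem_iota add0n => hj _ [-> _].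
by move=> hi; exists (i, d); rewrite mem_iota; split=> //; case: d.
Qed.

Lemma uniq_darts w : uniq (darts w).
Proof. by apply: allpairs_uniq; rewrite ?iota_uniq //= => -[? ?] [? ?]. Qed.

Lemma size_darts w : size (darts w) = (size w).*2.
Proof. by rewrite size_allpairs size_iota muln2. Qed.

(** The index of the passage at which a dart ends, where [next_dart] turns. *)
Definition dart_end (w : seq passage) (a : dart) : nat :=
  if a.2 then a.1.+1 %% size w else a.1.

Lemma dart_end_lt w a : dart_in w a -> dart_end w a < size w.
Proof.
rewrite /dart_end /dart_in; case: a => i [] //= hi.
by rewrite ltn_mod (leq_trans _ hi).
Qed.

Definition flip (a : dart) : dart := (a.1, ~~ a.2).

Lemma flipK : involutive flip.
Proof. by case=> i []. Qed.

Lemma well_formed_partner w e : well_formed w -> e \in w -> partner e \in w.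
Proof. by move=> wfw ew; case/andP: (allP wfw _ ew). Qed.

Lemma well_formed_uniq w : well_formed w -> uniq w.
Proof.
move=> wfw; apply: count_mem_uniq => e.
case: (boolP (e \in w)) => [ew|/count_memPn //].
have /andP[/eqP c2 pw] := allP wfw _ ew.
apply/eqP; rewrite eqn_leq -has_count has_pred1 ew andbT.
have : count_mem e w + count_mem (partner e) w <= 2.
  rewrite -c2 -[leqLHS]count_predUI.
  rewrite [X in _ + X](eq_count (a2 := pred0)) ?count_pred0 ?addn0.
    by apply: sub_count => f /= /orP[]/eqP->.
  move=> f /=; apply/negbTE/negP => /andP[/eqP-> /eqP] /esym/eqP.
  by rewrite (negbTE (partner_neq e)).
have : 0 < count_mem (partner e) w by rewrite -has_count has_pred1.
by case: (count_mem _ w) => // m _; rewrite addnS ltnS; case: (count_mem e w) => [|[]].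
Qed.

Lemma next_dart_in w a : well_formed w -> dart_in w a ->
  dart_in w (next_dart w a).
Proof.
move=> wfw ha; have he := dart_end_lt ha.
rewrite /next_dart -/(dart_end w a) /dart_in.
set e := nth _ w _; have : partner e \in w.
  by apply: well_formed_partner => //; apply: mem_nth.
by rewrite -index_mem; case: ifP => //= _ _; rewrite ltn_mod (leq_trans _ ha).
Qed.

(** Nothing in [is_face] bounds the indices of the darts, but [next_dart] maps
the darts of the code to themselves, so one of them in a cycle is enough. *)
Lemma is_face_in w c a : well_formed w -> is_face w c -> a \in c ->
  dart_in w a -> all (dart_in w) c.
Proof.
move=> wfw /and3P[_ _ cyc] ac ha; rewrite -(eq_all_r (mem_rot (index a c) c)).
move: cyc; rewrite -(rot_cycle (index a c)) (rot_index ac) /=.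
move: (_ ++ _) => p; rewrite rcons_path ha /= => /andP[+ _].
elim: p a ha {ac} => //= b p IH a ha /andP[/eqP <- hp].
by have hn := next_dart_in wfw ha; rewrite hn (IH (next_dart w a)).
Qed.

Lemma perm_darts_in w (fs : seq (seq dart)) c :
  perm_eq (flatten fs) (darts w) -> c \in fs -> all (dart_in w) c.
Proof.
move=> pf cf; apply/allP => a ac; rewrite -mem_darts -(perm_mem pf).
by apply/flattenP; exists c.
Qed.

(** ** Maps of passages that respect the faces *)

Section PassageMap.
Variables (m : passage -> passage) (w : seq passage).
Hypotheses (wfw : well_formed w) (m_inj : {in w &, injective m}).
Hypothesis m_partner : forall e, partner (m e) = m (partner e).

Lemma nth_index_map (k : nat) (e0 e1 : passage) : k < size w ->
  index (partner (nth e0 (map m w) k)) (map m w) = index (partner (nth e1 w k)) w.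
Proof.
move=> hk; rewrite (nth_map e1) // m_partner.
have pw := well_formed_partner wfw (mem_nth e1 hk).
rewrite -{1}(nth_index e1 pw) -(nth_map e1 e1 m) ?index_mem //.
by rewrite index_uniq ?size_map ?index_mem // map_inj_in_uniq ?well_formed_uniq.
Qed.

Lemma next_dart_map a : (forall e, side (m e) = side e) -> dart_in w a ->
  next_dart (map m w) a = next_dart w a.
Proof.
move=> m_side ha; have he := dart_end_lt ha; move: he; rewrite /dart_end => he.
rewrite /next_dart size_map (nth_index_map _ (0, Virt, false) he).
by rewrite (nth_map (0, Virt, false)) // m_side.
Qed.

(** Reversing all sides turns the plane over: a face, kept to the left, is then
run in the other direction along flipped darts. *)
Lemma next_dart_flip a : (forall e, side (m e) = ~~ side e) ->
  dart_in w a -> next_dart (map m w) (flip (next_dart w a)) = flip a.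
Proof.
move=> m_side ha; have he := dart_end_lt ha.
have n_gt0 : 0 < size w by apply: leq_trans ha.
pose e := nth (0, Virt, false) w (dart_end w a); have ew : e \in w by apply: mem_nth.
have pw := well_formed_partner wfw ew.
pose k := index (partner e) w; have hk : k < size w by rewrite index_mem.
have nk : nth (0, Virt, false) w k = partner e by rewrite nth_index.
(* The flipped dart ends where the partner of [e] stands. *)
have dend : (if ~~ (side e == a.2) then (if side e == a.2 then k
    else (k + (size w).-1) %% size w).+1 %% size w
  else (if side e == a.2 then k else (k + (size w).-1) %% size w)) = k.
  case: (side e == a.2) => //=.
  by rewrite -addn1 modnDml -addnA addn1 prednK // modnDr modn_small.
have -> : next_dart (map m w) (flip (next_dart w a)) =
    if side e == ~~ (side e == a.2) then (dart_end w a, true)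
    else ((dart_end w a + (size w).-1) %% size w, false).
  rewrite {2}/next_dart -/(dart_end w a) -/e -/k.
  set b := (if _ then (k, true) else _).
  have -> : flip b = (if side e == a.2 then k else (k + (size w).-1) %% size w,
                      ~~ (side e == a.2)) by rewrite /b; case: ifP.
  rewrite /next_dart size_map [_.2]/= [_.1]/= dend (nth_index_map _ (0, Virt, false) hk) nk.
  rewrite partnerK index_uniq ?well_formed_uniq //.
  by rewrite (nth_map (0, Virt, false)) // nk m_side negbK.
rewrite /flip /dart_end; case: a ha {he e ew pw k hk nk dend} (side e) => i d.
rewrite /dart_in /= => hi; case: d; case=> //=.
all: by rewrite modnDml addSnnS prednK // modnDr modn_small.
Qed.

Lemma is_face_map c : (forall e, side (m e) = side e) -> all (dart_in w) c ->
  is_face (map m w) c = is_face w c.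
Proof.
move=> m_side cin; rewrite /is_face.
rewrite (@eq_in_cycle _ (dart_in w) _ (frel (next_dart w))) // => a b ha _ /=.
by rewrite next_dart_map.
Qed.

Lemma is_face_flip c : (forall e, side (m e) = ~~ side e) ->
  all (dart_in w) c -> is_face w c -> is_face (map m w) (rev (map flip c)).
Proof.
move=> m_side cin /and3P[c0 cu cyc].
rewrite /is_face rev_uniq (map_inj_uniq (can_inj flipK)) cu rev_cycle cycle_map.
rewrite -size_eq0 size_rev size_map size_eq0 c0 /=.
apply: sub_in_cycle cin cyc => a b ha _ /= /eqP <-.
by rewrite next_dart_flip.
Qed.

Lemma well_formed_map (r : bool) : (forall e, side (m e) = side e (+) r) ->
  (forall e f, (label (m e) == label (m f)) = (label e == label f)) ->
  well_formed (map m w).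
Proof.
move=> m_side m_lab; apply/allP => _ /mapP[e ew ->].
have /andP[ce pe] := allP wfw e ew; rewrite m_partner map_f // andbT.
by rewrite count_map (eq_count (a2 := fun f => label f == label e)) // => f /=.
Qed.

Lemma planar_map : (forall e, side (m e) = side e) -> planar w ->
  planar (map m w).
Proof.
move=> m_side [->|[fs [ff pf eul]]]; [by left | right; exists fs].
rewrite /darts !size_map; split=> //; apply/allP => c cf.
by rewrite is_face_map ?(allP ff) // (perm_darts_in pf).
Qed.

Lemma planar_flip : (forall e, side (m e) = ~~ side e) ->
  planar w -> planar (map m w).
Proof.
move=> m_side [->|[fs [ff pf eul]]]; [by left | right].
exists [seq rev (map flip c) | c <- fs]; rewrite !size_map; split=> //.
  apply/allP => _ /mapP[c cf ->].
  by apply: is_face_flip => //; [apply: perm_darts_in pf cf | apply: (allP ff)].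
apply: (@perm_trans _ (map flip (flatten fs))).
  elim: (fs) => //= c l IH; rewrite map_cat perm_cat // perm_sym.
  by rewrite perm_sym perm_rev.
apply: perm_trans (perm_map flip pf) _.
apply: uniq_perm; rewrite ?(map_inj_uniq (can_inj flipK)) ?uniq_darts //.
move=> a; rewrite -{1}(flipK a) (mem_map (can_inj flipK)) !mem_darts.
by rewrite /dart_in size_map.
Qed.

End PassageMap.

(** ** Deciding planarity *)

Fixpoint walk (T : eqType) (f : T -> T) (a : T) (n : nat) (x : T) : seq T :=
  if n is m.+1 then if x == a then [::] else x :: walk f a m (f x) else [::].

Lemma walkE (T : eqType) (f : T -> T) a n x p :
  fpath f x (rcons p a) -> a \notin p -> size p < n -> walk f a n (f x) = p.
Proof.
elim: p n x => [|y p IH] [|n] x //=; first by rewrite andbT => ->.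
case/andP => /eqP -> hp; rewrite inE negb_or eq_sym => /andP[/negbTE -> ap] hn.
by rewrite IH.
Qed.

Definition face_of (w : seq passage) (a : dart) : seq dart :=
  a :: walk (next_dart w) a (size w).*2 (next_dart w a).

(** A face is a simple cycle, hence the orbit of any of its darts up to the first
return; it has at most as many darts as the code. *)
Lemma face_ofE w c a : is_face w c -> all (dart_in w) c -> a \in c ->
  face_of w a = rot (index a c) c.
Proof.
move=> /and3P[_ cu cyc] cin ac; rewrite /face_of (rot_index ac).
have szc : size c <= (size w).*2.
  rewrite -size_darts uniq_leq_size // => b bc.
  by rewrite mem_darts (allP cin).
move: cyc cu szc; rewrite -(rot_cycle (index a c)) -(rot_uniq (index a c)).
rewrite -(size_rot (index a c)) (rot_index ac) /=; move: (_ ++ _) => p.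
by move=> hp /andP[ap _] szc; rewrite (walkE hp).
Qed.

(** Every face has exactly one leader, its first dart, so the leaders count
the faces. *)
Definition leads (w : seq passage) (a : dart) : bool :=
  all (fun b => index a (darts w) <= index b (darts w)) (face_of w a).

(** A necessary condition for planarity, used to discard codes. *)
Definition genus0 (w : seq passage) : bool :=
  (w == [::]) || ((size w)./2 + count (leads w) (darts w) == size w + 2).

Lemma count_leads w c : is_face w c -> all (dart_in w) c -> count (leads w) c = 1.
Proof.
move=> fc cin; have /and3P[c0 cu _] := fc.
pose rank b := index b (darts w).
have exr : exists n, has (fun b => rank b == n) c.
  by case: (c) c0 => // b l _; exists (rank b); rewrite /= eqxx.
have [n /hasP[x xc /eqP rx] minx] := ex_minnP exr.
rewrite (eq_in_count (a2 := pred1 x)) ?count_uniq_mem ?xc // => b bc.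
rewrite /leads (face_ofE fc cin bc) (eq_all_r (mem_rot _ _)) /=.
apply/allP/eqP => [hb | -> y yc].
  have := hb _ xc; rewrite -/(rank b) -/(rank x) rx => le.
  have : rank b = rank x.
    by apply/eqP; rewrite eqn_leq rx le minx //; apply/hasP; exists b.
  move/(congr1 (nth b (darts w))); rewrite !nth_index // mem_darts.
    exact: (allP cin).
  exact: (allP cin).
by rewrite -/(rank x) -/(rank y) rx minx //; apply/hasP; exists y.
Qed.

Lemma planar_genus0 w : planar w -> genus0 w.
Proof.
rewrite /genus0; case=> [->|[fs [ff pf eul]]]; first by [].
apply/orP; right; rewrite -(permP pf) -eul eqn_add2l count_flatten.
have hin c : c \in fs -> all (dart_in w) c by apply: perm_darts_in.
apply/eqP; elim: (fs) ff hin => //= c l IH /andP[fc fl] hin.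
rewrite count_leads ?hin ?mem_head // IH // => d dl.
by rewrite hin // inE dl orbT.
Qed.

Fixpoint faces_from (w : seq passage) (ds : seq dart) (fs : seq (seq dart)) :=
  if ds is a :: ds' then
    faces_from w ds' (if has (fun c => a \in c) fs then fs else face_of w a :: fs)
  else fs.

(** A sufficient condition for planarity, used to certify diagrams: the faces
found by following the darts do satisfy the definition. *)
Definition planarb (w : seq passage) : bool :=
  (w == [::]) ||
  let fs := faces_from w (darts w) [::] in
  [&& all (is_face w) fs, perm_eq (flatten fs) (darts w)
    & (size w)./2 + size fs == size w + 2].

Definition planeb (D : diagram) : bool :=
  well_formed (code D) && planarb (code D).

Lemma planeb_sound D : planeb D -> plane_diagram D.
Proof.
case/andP => wfD /orP[/eqP e|/and3P[? ? /eqP ?]]; split=> //; [by left|right].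
by eexists; split; eassumption.
Qed.

(** * Mirror images *)

Definition mirror_passage (v h : bool) (e : passage) : passage :=
  (label e, if v then opposite (kind e) else kind e, side e (+) h).

(** The four mirror images at once: [v] switches the strands, [h] reflects the
plane. *)
Definition mirror (v h : bool) (D : diagram) : diagram :=
  Diagram (outer_left D (+) h) [seq mirror_passage v h e | e <- code D].

Lemma mirror_passageK v h : involutive (mirror_passage v h).
Proof. by move: v h => [] [] [[l []] []]. Qed.

Lemma mirrorK v h : involutive (mirror v h).
Proof.
case=> o w; rewrite /mirror /= addbK -map_comp map_id_in // => e _ /=.
exact: mirror_passageK.
Qed.

Lemma partner_mirror v h e :
  partner (mirror_passage v h e) = mirror_passage v h (partner e).
Proof. by move: v h e => [] [] [[l []] []]. Qed.

Lemma up_to_mirrorP (P : diagram -> Prop) D :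
  up_to_mirror_images P D <-> exists v h, P (mirror v h D).
Proof.
have e00 E : mirror false false E = E.
  case: E => o w; rewrite /mirror /= addbF map_id_in // => -[[l k] s] _.
  by rewrite /mirror_passage /side /= addbF.
have e01 E : mirror false true E = horizontal_mirror E.
  case: E => o w; rewrite /mirror /horizontal_mirror /= addbT; congr Diagram.
  by apply: eq_map => e; rewrite /mirror_passage addbT.
have e10 E : mirror true false E = vertical_mirror E.
  case: E => o w; rewrite /mirror /vertical_mirror /= addbF; congr Diagram.
  by apply: eq_map => e; rewrite /mirror_passage addbF.
have e11 E : mirror true true E = horizontal_mirror (vertical_mirror E).
  case: E => o w; rewrite /mirror /horizontal_mirror /= addbT; congr Diagram.
  by rewrite -map_comp; apply: eq_map => e; rewrite /mirror_passage addbT.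
split.
  case=> H; [exists false, false|exists false, true|exists true, false
            |exists true, true]; by rewrite ?e00 ?e01 ?e10 ?e11.
case=> -[] [[]]; rewrite ?e00 ?e01 ?e10 ?e11 => H.
- exact: Or44.
- exact: Or43.
- exact: Or42.
- exact: Or41.
Qed.

Section Mirror.
Variables v h : bool.
Let m := mirror_passage v h.

Let m_inj (w : seq passage) : {in w &, injective m}.
Proof. by move=> e f _ _; apply: (can_inj (mirror_passageK v h)). Qed.
Let m_partner e : partner (m e) = m (partner e). Proof. exact: partner_mirror. Qed.
Let m_side e : side (m e) = side e (+) h. Proof. by []. Qed.

Lemma plane_mirror D : plane_diagram D -> plane_diagram (mirror v h D).
Proof.
case: D => o w [wfw pw]; split=> /=.
  by apply: (well_formed_map wfw _ m_side).
case hE: h (m_inj (w := w)) m_partner m_side; rewrite {}/m hE => mi mp ms.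
  by apply: planar_flip => // e; rewrite ms addbT.
by apply: planar_map => // e; rewrite ms addbF.
Qed.

Definition mirror_dart (a : dart) : dart := (a.1, a.2 (+) h).

(** Faces as sets of darts are what the moves depend on, so it does not matter
that a reflection reverses their cyclic order. *)
Lemma is_face_mirror w c : well_formed w -> all (dart_in w) c -> is_face w c ->
  exists2 c', is_face (map m w) c' & perm_eq c' (map mirror_dart c).
Proof.
rewrite /mirror_dart => wfw cin fc.
case hE: h (m_inj (w := w)) m_partner m_side; rewrite {}/m hE => mi mp ms.
  exists (rev (map flip c)).
    by apply: is_face_flip => // e; rewrite ms addbT.
  by rewrite perm_rev (eq_map (g := flip)) // => a; rewrite addbT.
exists c; first by rewrite is_face_map // => e; rewrite ms addbF.
by rewrite map_id_in // => -[i d] _; rewrite addbF.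
Qed.

Lemma bounds_face_mirror w arcs : well_formed w ->
  all (fun i => i < size w) arcs -> bounds_face w arcs ->
  bounds_face (map m w) arcs.
Proof.
move=> wfw ain [c fc pc].
have cin : all (dart_in w) c.
  by apply/allP => a ac; apply: (allP ain); rewrite -(perm_mem pc) map_f.
have [c' fc' pc'] := is_face_mirror wfw cin fc; exists c' => //.
by apply: perm_trans (perm_map _ pc') _; rewrite -map_comp.
Qed.

Lemma move_mirror D D' : plane_diagram D -> move D D' ->
  move (mirror v h D) (mirror v h D').
Proof.
move=> [wfD _] mv; case: mv wfD => /=.
- move=> o w f f_inj _; have := relabel (o (+) h) (map m w) f_inj.
  by rewrite /mirror /= -!map_comp.
- move=> o w j d c hj fc oc dc wfw.
  have lin : dart_in w ((size w).-1, o).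
    by rewrite /dart_in /= prednK // (leq_trans _ hj).
  have [c' fc' pc'] := is_face_mirror wfw (is_face_in wfw fc oc lin) fc.
  rewrite /mirror /= map_rot; apply: rebase fc' _ _; rewrite ?size_map //.
    by rewrite (perm_mem pc') -[(_, _)]/(mirror_dart ((size w).-1, o)) map_f.
  by rewrite (perm_mem pc') -[(_, _)]/(mirror_dart (j, d)) map_f.
- by move=> o w _; rewrite /mirror /= map_rev addNb; apply: reverse.
- move=> o x p q y bf wfw; rewrite /mirror /= !map_cat; apply: move1.
  have := bounds_face_mirror wfw _ bf; rewrite !map_cat /= size_map; apply.
  by rewrite !size_cat /=; lia.
- move=> o x p1 q1 y p2 q2 z bf ek wfw.
  have := @move2 (o (+) h) (map m x) (m p1) (m q1) (map m y) (m p2) (m q2) (map m z).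
  rewrite /mirror /= !(map_cat, map_cons); apply; last first.
    by rewrite /m /mirror_passage /kind /= -!/(kind _) ek.
  have := bounds_face_mirror wfw _ bf.
  rewrite !(map_cat, map_cons, size_cat, size_map) /=.
  rewrite !(map_cat, map_cons, size_cat, size_map) /=; apply.
  by lia.
- move=> o x p1 q1 y p2 q2 z p3 q3 t bf ek wfw.
  have := @move3 (o (+) h) (map m x) (m p1) (m q1) (map m y) (m p2) (m q2) (map m z)
    (m p3) (m q3) (map m t).
  rewrite /mirror /= !(map_cat, map_cons); apply; last first.
    move: ek; rewrite /m /mirror_passage /kind /= -!/(kind _); case: v => //.
    by case: (kind p1); case: (kind q1); case: (kind p2); case: (kind q2);
      case: (kind p3); case: (kind q3).
  have := bounds_face_mirror wfw _ bf.
  rewrite !(map_cat, map_cons, size_cat, size_map) /= !(map_cat, map_cons, size_cat, size_map) /=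
    !(map_cat, map_cons, size_cat, size_map) /=; apply.
  by lia.
Qed.
End Mirror.

Lemma equivalent_mirror v h D D' : virtually_equivalent D D' ->
  virtually_equivalent (mirror v h D) (mirror v h D').
Proof.
elim=> {D D'} [D D' [pD pD' mv]|D|D D' _ IH|D E D' _ IH1 _ IH2].
- by apply: rst_step; split; [exact: plane_mirror..|exact: move_mirror].
- exact: rst_refl.
- exact: rst_sym.
- exact: rst_trans IH1 IH2.
Qed.

(** Either all the diagrams of a chain of moves are plane, or the chain is
empty. *)
Lemma equivalent_plane D D' : virtually_equivalent D D' ->
  plane_diagram D <-> plane_diagram D'.
Proof.
by elim=> {D D'} [D D' []|D|D D' _ []|D E D' _ [? ?] _ [? ?]] //; split; auto.
Qed.

(** * Computing with diagrams *)

Definition diagram_pair (D : diagram) := (outer_left D, code D).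

Lemma diagram_pairK : cancel diagram_pair (fun p => Diagram p.1 p.2).
Proof. by case. Qed.

HB.instance Definition _ := Equality.copy diagram (can_type diagram_pairK).

Lemma equivalent_move D D' : plane_diagram D -> plane_diagram D' ->
  move D D' -> virtually_equivalent D D'.
Proof. by move=> ? ? ?; apply: rst_step. Qed.

(** Labels each double point by the place of its first passage, so that codes
which differ by a change of labels become equal. *)
Definition canon (w : seq passage) : seq passage :=
  [seq (index (label e) (map label w), kind e, side e) | e <- w].

Lemma canon_relabel w : exists2 f : nat -> nat, injective f &
  canon w = [seq (f (label e), kind e, side e) | e <- w].
Proof.
pose ls := map label w.
(* [relabel] asks for an injection of all of [nat]: the other labels are moved
   beyond the places in the code. *)
exists (fun x => if x \in ls then index x ls else x + size ls); last first.
  by apply/eq_in_map => e ew; rewrite map_f.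
move=> x y; case: ifP => xl; case: ifP => yl.
- exact: index_inj.
- by have := xl; rewrite -index_mem => lt e; move: lt; rewrite e ltnNge leq_addl.
- by have := yl; rewrite -index_mem => lt e; move: lt; rewrite -e ltnNge leq_addl.
- exact: addIn.
Qed.

Lemma plane_canon o w : plane_diagram (Diagram o w) ->
  plane_diagram (Diagram o (canon w)).
Proof.
case=> wfw pw; have [f f_inj ->] := canon_relabel w.
pose m e : passage := (f (label e), kind e, side e).
have m_inj : injective m.
  by move=> [[l k] s] [[l' k'] s']; rewrite /m /label /kind /side /= => -[/f_inj -> -> ->].
split=> /=.
  apply: (@well_formed_map m _ wfw) (false) _ _ => // e; first by rewrite addbF.
  by move=> e'; rewrite /m /label /= (inj_eq f_inj).
by apply: (@planar_map m) => // e e' _ _; apply: m_inj.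
Qed.

Lemma equivalent_canon o w : plane_diagram (Diagram o w) ->
  virtually_equivalent (Diagram o w) (Diagram o (canon w)).
Proof.
move=> pw; apply: equivalent_move => //; first exact: plane_canon.
by have [f f_inj ->] := canon_relabel w; apply: relabel.
Qed.

(** The same curve based at the other arcs of the unbounded face. *)
Definition rebases (D : diagram) : seq diagram :=
  let w := code D in
  let c := face_of w ((size w).-1, outer_left D) in
  if is_face w c then [seq Diagram a.2 (rot a.1.+1 w) | a <- c & dart_in w a]
  else [::].

(** The face to the left of [a] when it is a monogon or a bigon. *)
Definition small_face (w : seq passage) (a : dart) : seq dart :=
  let b := next_dart w a in
  if b == a then [:: a] else if next_dart w b == a then [:: a; b] else [::].

(** What remains of [D] when move I or II removes the face [c]. *)
Definition shrink (D : diagram) (c : seq dart) : option diagram :=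
  let: Diagram o w := D in
  let e0 := (0, Virt, false) in
  match c with
  | [:: (i, _)] =>
    if i.+1 < size w then Some (Diagram o (take i w ++ drop i.+2 w)) else None
  | [:: (i, _); (j, _)] =>
    if [&& i.+1 < j, j.+1 < size w & kind (nth e0 w i) == kind (nth e0 w i.+1)]
    then Some (Diagram o (take i w ++ take (j - i.+2) (drop i.+2 w) ++ drop j.+2 w))
    else None
  | _ => None
  end.

Fixpoint first_some (T U : Type) (f : T -> option U) (s : seq T) : option U :=
  if s is x :: s' then if f x is Some y then Some y else first_some f s'
  else None.

(** The diagram itself is returned too, as one of several base points is being
tried. *)
Definition shrink_somewhere (D : diagram) : option (diagram * diagram) :=
  omap (pair D)
    (first_some (fun a => shrink D (small_face (code D) a)) (darts (code D))).

(** Greedy removal of monogons and bigons.  Moves are restricted to faces off the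
base arc, hence the search through the base points. *)
Fixpoint normalize (n : nat) (D : diagram) : diagram :=
  if n is m.+1 then
    if first_some shrink_somewhere (rebases D) is Some (D1, D2) then
      if planeb D1 && planeb D2 then normalize m D2 else D
    else D
  else D.

Definition canon_diagram (D : diagram) : diagram :=
  Diagram (outer_left D) (canon (code D)).

(** A diagram that cannot be simplified any more is recognized by its code from
one of its base points. *)
Definition reduces_to (Ms : seq diagram) (D : diagram) : bool :=
  let N := normalize (size (code D)) D in
  let targets := map canon_diagram Ms in
  has (fun D' => if canon_diagram D' \in targets then planeb D' else false)
    (N :: rebases N).

Lemma first_some_mem (T : eqType) (U : Type) (f : T -> option U) s y :
  first_some f s = Some y -> exists2 x, x \in s & f x = Some y.
Proof.
elim: s => //= x s IH; case E: (f x) => [z|] => [[<-]|/IH[z zs hz]].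
  by exists x; rewrite ?mem_head.
by exists z; rewrite // inE zs orbT.
Qed.

Lemma rebases_sound D D' : plane_diagram D -> plane_diagram D' ->
  D' \in rebases D -> virtually_equivalent D D'.
Proof.
case: D => o w pD pD'; rewrite /rebases [code _]/= [outer_left _]/=.
case: ifP => // fc /mapP[[j d]]; rewrite mem_filter => /andP[hj ac] eD.
apply: equivalent_move => //; rewrite eD /=.
by apply: rebase hj fc _ _; rewrite // mem_head.
Qed.

Lemma is_face_small w a : small_face w a != [::] -> is_face w (small_face w a).
Proof.
rewrite /small_face /is_face; move: (next_dart w) => f.
case: (f a =P a) => [e|/eqP ne]; first by rewrite /= e eqxx.
case: (f (f a) =P a) => // e _.
by rewrite /= e !eqxx !andbT mem_seq1 eq_sym.
Qed.

Lemma split_pair (T : Type) (x0 : T) (s : seq T) i : i.+1 < size s ->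
  s = take i s ++ [:: nth x0 s i; nth x0 s i.+1] ++ drop i.+2 s.
Proof.
move=> hi; rewrite -{1}(cat_take_drop i s) (drop_nth x0 (ltnW hi)).
by rewrite (drop_nth x0 hi).
Qed.

Lemma shrink_sound D D' c : is_face (code D) c -> shrink D c = Some D' ->
  move D D'.
Proof.
case: D => o w /= fc; case: c fc => [|[i d] [|[j e] [|//]]] //= fc; case: ifP => //.
  move=> hi [<-].
  have ew := split_pair (0, Virt, false) hi.
  rewrite [X in move (Diagram _ X)]ew; apply: move1; rewrite -ew.
  exists [:: (i, d)] => //; have -> : size (take i w) = i by rewrite size_take_min; lia.
  by [].
case/and3P=> hij hj /eqP ek [<-].
set e0 : passage := (0, Virt, false) in ek *.
have ew : w = take i w ++ [:: nth e0 w i; nth e0 w i.+1] ++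
   take (j - i.+2) (drop i.+2 w) ++ [:: nth e0 w j; nth e0 w j.+1] ++ drop j.+2 w.
  rewrite {1}(@split_pair _ e0 w i); last by lia.
  rewrite {1}(@split_pair _ e0 (drop i.+2 w) (j - i.+2)); last by rewrite size_drop; lia.
  rewrite !nth_drop drop_drop; do 4 congr (_ ++ _).
  - by rewrite /= addnS subnKC.
  - by congr drop; lia.
rewrite [X in move (Diagram _ X)]ew; apply: move2 => //; rewrite -ew.
exists [:: (i, d); (j, e)] => //=.
have -> : size (take i w) = i by rewrite size_take_min; lia.
set u := size (_ ++ _); have -> : u = j; last by [].
by rewrite /u !size_cat /= !size_take_min size_drop /=; lia.
Qed.

Lemma normalize_sound n D : plane_diagram D ->
  plane_diagram (normalize n D) /\ virtually_equivalent D (normalize n D).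
Proof.
elim: n D => [|n IH] D pD /=; first by split=> //; apply: rst_refl.
have eD : plane_diagram D /\ virtually_equivalent D D by split=> //; apply: rst_refl.
case E: (first_some _ _) => [[D1 D2]|//].
case: andP => [[/planeb_sound p1 /planeb_sound p2]|//].
have [D' hD'] := first_some_mem E; rewrite /shrink_somewhere.
case E': (first_some _ _) => [D3|//] [e1 e2]; rewrite {D3}e2 in E'.
rewrite {D'}e1 in hD' E'; have [a _ ha] := first_some_mem E'.
have [p3 e3] := IH _ p2; split=> //.
apply: rst_trans (rebases_sound pD p1 hD') _; apply: rst_trans e3.
apply: equivalent_move => //; apply: (shrink_sound _ ha); apply: is_face_small.
by apply/eqP => e0; move: ha; rewrite e0; case: (D1).
Qed.

Lemma reduces_to_sound Ms D : {in Ms, forall M, plane_diagram M} ->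
  plane_diagram D -> reduces_to Ms D ->
  exists2 M, M \in Ms & virtually_equivalent D M.
Proof.
move=> pMs pD; have [pN eN] := normalize_sound (size (code D)) pD.
case/hasP => D' hD'; case: ifP => // /mapP[M MMs eM] /planeb_sound pD'.
exists M => //; apply: rst_trans eN _; apply: (@rst_trans _ _ _ D').
  by move: hD'; rewrite inE => /orP[/eqP->|/(rebases_sound pN pD')//]; apply: rst_refl.
have canonE E : plane_diagram E -> virtually_equivalent E (canon_diagram E).
  by case: E => o w; apply: equivalent_canon.
apply: rst_trans (canonE _ pD') _; rewrite eM.
by apply: rst_sym; apply: canonE; apply: pMs.
Qed.

(** * Diagrams with at most two double points *)

Definition unknot (o : bool) : diagram := Diagram o [::].

Lemma plane_unknot o : plane_diagram (unknot o).
Proof. by split=> //; left. Qed.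

(** Only two passages bear a given label. *)
Lemma well_formed_label w e f : well_formed w -> e \in w -> f \in w ->
  label e = label f -> e = f \/ e = partner f.
Proof.
move=> wfw ew fw el; have /andP[/eqP c2 pf] := allP wfw _ fw.
case: (altP (e =P f)) => [|nef]; first by left.
case: (altP (e =P partner f)) => [|nep]; first by right.
have : size [:: e; f; partner f] <= size [seq g <- w | label g == label f].
  apply: uniq_leq_size => /= [|g].
    by rewrite !inE negb_or nef nep eq_sym partner_neq.
  rewrite !inE mem_filter => /or3P[]/eqP->; rewrite ?el ?ew ?fw ?pf ?eqxx //.
by rewrite size_filter c2.
Qed.

(** The passages that may follow the beginning [u] of a canonical code: the
second passage of a double point that is open, or the first passage of a new one,
labelled by its place. *)
Definition next_passages (u : seq passage) : seq passage :=
  [seq partner f | f <- u & partner f \notin u] ++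
  [seq (size u, k, s) | k <- [:: Over; Under; Virt], s <- [:: true; false]].

Fixpoint all_codes (n : nat) (P : pred (seq passage)) (u : seq passage) : bool :=
  if n is m.+1 then all (fun e => all_codes m P (rcons u e)) (next_passages u)
  else P u.

Lemma canon_next_passages w u e x : well_formed (canon w) ->
  canon w = u ++ e :: x -> e \in next_passages u.
Proof.
move=> wfw ew; have hk : size u < size w.
  by move/(congr1 size): ew; rewrite size_map size_cat /= => ->; rewrite addnS ltnS leq_addr.
have uw : uniq (u ++ e :: x) by rewrite -ew well_formed_uniq.
have ue : e \notin u.
  by move: uw; rewrite cat_uniq => /and3P[_ + _]; rewrite /= negb_or => /andP[].
set e0 : passage := (0, Virt, false).
have ee : e = nth e0 (canon w) (size u) by rewrite ew nth_cat ltnn subnn.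
rewrite (nth_map e0) // in ee; set e' := nth e0 w (size u) in ee.
have el : label e = index (label e') (map label w) by rewrite ee.
have le : label e <= size u.
  rewrite el -(cat_take_drop (size u).+1 (map label w)) index_cat -map_take.
  have e'u : label e' \in [seq label i | i <- take (size u).+1 w].
    by apply: map_f; rewrite (take_nth e0) // mem_rcons mem_head.
  rewrite e'u -ltnS (leq_trans (n := size [seq label i | i <- take (size u).+1 w])) //.
    by rewrite index_mem.
  by rewrite size_map size_take_min geq_minl.
rewrite mem_cat; move: le; rewrite leq_eqVlt => /orP[/eqP le|lt].
  apply/orP; right; apply/allpairsP; exists (kind e, side e).
  by rewrite /= -le; split; [case: (kind e) | case: (side e) | case: (e) => [[]]].
apply/orP; left; pose f := nth e0 u (label e).
have fu : f \in u by apply: mem_nth.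
have fw : f \in canon w by rewrite ew mem_cat fu.
have lw : label e < size w by apply: ltn_trans hk.
have fl : label f = label e.
  have -> : f = nth e0 (canon w) (label e) by rewrite ew nth_cat lt.
  rewrite (nth_map e0) // {1}/label /=.
  have -> : label (nth e0 w (label e)) = label e'.
    rewrite -(nth_map e0 0 label) // el nth_index // map_f //.
    by apply: mem_nth.
  by rewrite -el.
have ewm : e \in canon w by rewrite ew mem_cat mem_head orbT.
case: (well_formed_label wfw ewm fw (esym fl)) => [ef|ep].
  by rewrite ef fu in ue.
by apply/mapP; exists f => //; rewrite mem_filter -ep ue.
Qed.

Lemma all_codesP n P u x w : well_formed (canon w) -> canon w = u ++ x ->
  size x = n -> all_codes n P u -> P (canon w).
Proof.
move=> wfw; elim: n u x => [|n IH] u [|e x] //= ew; first by rewrite ew cats0.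
case=> sx /allP hP; apply: (IH (rcons u e) x); rewrite ?cat_rcons //.
by apply: hP; apply: canon_next_passages ew.
Qed.

Definition unknots : seq diagram := [:: unknot true; unknot false].

Lemma plane_unknots : {in unknots, forall M, plane_diagram M}.
Proof. by move=> M; rewrite !inE => /orP[]/eqP->; apply: plane_unknot. Qed.

(** Here and in the tests below, conditionals in place of conjunctions let the
evaluation stop at the first failure. *)
Definition trivial_code (w : seq passage) : bool :=
  if well_formed w then
    if genus0 w then all (fun o => reduces_to unknots (Diagram o w)) [:: true; false]
    else true
  else true.

(** There are few canonical codes of length at most 4, and the simplification of
the plane ones ends with the empty code. *)
Lemma few_crossings_unknot D : plane_diagram D -> size (code D) <= 4 -> is_unknot D.
Proof.
case: D => o w pD /= sw; have [wfw pw] := plane_canon pD.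
have : trivial_code (canon w).
  apply: (@all_codesP (size w) _ [::] (canon w)); rewrite ?size_map //.
  have : all (fun n => all_codes n trivial_code [::]) (iota 0 5) by vm_compute.
  by move/allP; apply; rewrite mem_iota.
rewrite /trivial_code wfw (planar_genus0 pw) => /allP/(_ o) H.
have {}H := H ltac:(by case: (o)).
have [|M Ms e] := reduces_to_sound plane_unknots _ H; first by split.
exists (outer_left M); apply: rst_trans (equivalent_canon pD) _.
by move: Ms e; rewrite !inE => /orP[]/eqP->.
Qed.

Definition basic_forms : seq diagram := unknots ++ [:: knot_2_1; knot_3_5].

Definition standard_forms : seq diagram :=
  [seq mirror vh.1 vh.2 M
  | vh <- [seq (v, h) | v <- [:: false; true], h <- [:: false; true]],
    M <- basic_forms].

Lemma plane_standard : {in standard_forms, forall M, plane_diagram M}.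
Proof.
move=> _ /allpairsP[[[v h] M] [_ /= hM ->]]; apply: plane_mirror.
move: hM; rewrite mem_cat => /orP[/plane_unknots //|].
rewrite !inE => /orP[]/eqP->; [exact: plane_diagram_2_1 | exact: plane_diagram_3_5].
Qed.

Import Order.TTheory GRing.Theory Num.Theory.


(** * Sign patterns of a pentagon *)

(** The sign of a real number: [None] for zero, [Some true] for positive. *)
Definition sgn : Type := option bool.

Definition sgn_mul (x y : sgn) : sgn :=
  if x is Some a then if y is Some b then Some (a == b) else None else None.

Definition sgn_opp (x : sgn) : sgn := omap negb x.

(** What the signs of terms with sum zero satisfy: both signs occur, or none. *)
Definition balanced (l : seq sgn) : bool := (Some true \in l) == (Some false \in l).

Fixpoint sgn_vectors (n : nat) : seq (seq sgn) :=
  if n is m.+1 then [seq x :: v | x <- [:: None; Some true; Some false], v <- sgn_vectors m]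
  else [:: [::]].

Definition at5 (l : seq sgn) (k : nat) : sgn := nth None l (k %% 5).

(** In this section [a k] is the sign of the turn from the edge [k] to the next
one, [b k] tells the side of the edge [k] on which the vertex [k + 3] lies, and
[w k] is the sign of the volume of the tetrahedron on the edges [k] and [k + 2],
which omits the vertex [k + 4].  So the vertex [j] has the coefficient of index
[j + 1] in the affine relation between the five vertices. *)
Section Signs.
Variables a b w : seq sgn.

(** Either diagonal cuts the quadrilateral of the vertices from [k] to [k + 3]
into two triangles, and the two sums of areas agree. *)
Definition area_rel (k : nat) : bool :=
  balanced [:: at5 a (k + 1); at5 b k; sgn_opp (at5 a k); sgn_opp (at5 b (k + 2))].

(** The affine relation, measured by the distance to the line of the edge [k]. *)
Definition edge_rel (k : nat) : bool :=
  balanced [:: sgn_mul (at5 a k) (at5 w (k + 3)); sgn_mul (at5 b k) (at5 w (k + 4));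
               sgn_mul (at5 a (k + 4)) (at5 w k)].

(** The affine relation, measured by the distance to the line through the
vertices [k] and [k + 2]. *)
Definition diagonal_rel (k : nat) : bool :=
  balanced [:: sgn_opp (sgn_mul (at5 a k) (at5 w (k + 2)));
               sgn_mul (at5 b (k + 2)) (at5 w (k + 4)); sgn_mul (at5 b (k + 4)) (at5 w k)].

(** The vertex 0 is not inside the triangle of the vertices 1, 2 and 3. *)
Definition extreme_rel : bool := balanced [:: at5 b 2; sgn_opp (at5 b 0); at5 a 0].

(** The edges [k] and [k + 2] cross when each of them has its ends on different
sides of the other. *)
Definition crosses (k : nat) : bool :=
  if sgn_mul (at5 a k) (at5 b k) == Some false
  then sgn_mul (at5 b (k + 2)) (at5 a (k + 1)) == Some false else false.

Definition plane_rels : bool :=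
  if count crosses (iota 0 5) < 3 then false
  else if all area_rel (iota 0 5) then extreme_rel else false.

Definition space_rels : bool :=
  if balanced w then
    if all edge_rel (iota 0 5) then all diagonal_rel (iota 0 5) else false
  else false.

(** The signs that the diagram depends on: those of the crossings that exist, and
the side of the unbounded face. *)
Definition outcome : seq sgn * seq sgn * bool :=
  ([seq if crosses k then at5 b k else None | k <- iota 0 5],
   [seq if crosses k then at5 w k else None | k <- iota 0 5],
   at5 a 4 == Some false).
End Signs.

Definition outcomes : seq (seq sgn * seq sgn * bool) :=
  let vs := sgn_vectors 5 in
  undup (flatten [seq flatten [seq if plane_rels a b then
     [seq outcome a b w | w <- vs & space_rels a b w] else [::] | b <- vs] | a <- vs]).

(** Of two edges that are two steps apart modulo 5, the first is the one from
which the other is reached forwards. *)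
Definition first_edge (q : nat * nat) : bool := q.2 == (q.1 + 2) %% 5.

Definition crossing_index (q : nat * nat) : nat := if first_edge q then q.1 else q.2.

(** The passage of the edge [q.1] through the edge [q.2].  The volume has the sign
of the crossing, so it agrees with the side exactly on the upper edge. *)
Definition pentagon_passage (b w : seq sgn) (virt : seq bool) (q : nat * nat) : passage :=
  let k := crossing_index q in
  let sd := (at5 b k == Some true) == first_edge q in
  (k, if nth true virt k then Virt
      else if at5 w k == Some sd then Over else Under, sd).

Definition edge_row (b : seq sgn) (k : nat) : seq (nat * nat) :=
  [seq q <- [:: (k, (k + 2) %% 5); (k, (k + 3) %% 5)] | at5 b (crossing_index q) != None].

(** The order of the passages along each edge is left open. *)
Fixpoint arrangements (b : seq sgn) (ks : seq nat) : seq (seq (nat * nat)) :=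
  if ks is k :: ks' then
    [seq p ++ r | p <- permutations (edge_row b k), r <- arrangements b ks']
  else [:: [::]].

Fixpoint virtual_choices (b : seq sgn) : seq (seq bool) :=
  if b is x :: b' then
    [seq c :: v | c <- if x is None then [:: true] else [:: true; false],
                  v <- virtual_choices b']
  else [:: [::]].

(** The code when [L] lists the passages in the order in which they are met. *)
Definition pentagon_code (b w : seq sgn) (virt : seq bool) (L : seq (nat * nat)) :=
  canon [seq pentagon_passage b w virt q | q <- L].

Definition outcome_ok (Ls : seq (seq (nat * nat))) (x : seq sgn * seq sgn * bool) : bool :=
  all (fun L => all (fun virt => let c := pentagon_code x.1.1 x.1.2 virt L in
      if well_formed c then reduces_to standard_forms (Diagram x.2 c) else true)
    (virtual_choices x.1.1)) Ls.

Definition plane_arrangements (b : seq sgn) : seq (seq (nat * nat)) :=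
  [seq L <- arrangements b (iota 0 5) | genus0 (pentagon_code b [::] (nseq 5 true) L)].

(** Planarity does not depend on the kinds of the crossings, so the orders along
the edges are sifted once for all patterns with the same shadow. *)
Definition outcomes_ok (xs : seq (seq sgn * seq sgn * bool)) : bool :=
  all (fun b => let Ls := plane_arrangements b in
      all (fun x => if x.1.1 == b then outcome_ok Ls x else true) xs)
    (undup [seq x.1.1 | x <- xs]).

Lemma outcomes_okT : outcomes_ok outcomes.
Proof. by vm_compute. Qed.

Lemma outcome_reduces b w o L virt : (b, w, o) \in outcomes ->
  L \in arrangements b (iota 0 5) -> genus0 (pentagon_code b [::] (nseq 5 true) L) ->
  virt \in virtual_choices b -> well_formed (pentagon_code b w virt L) ->
  reduces_to standard_forms (Diagram o (pentagon_code b w virt L)).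
Proof.
move: outcomes outcomes_okT => xs ok xin Lin gen vin wf.
have bin : b \in undup [seq x.1.1 | x <- xs].
  by rewrite mem_undup; apply/mapP; exists (b, w, o).
have {ok}/allP/(_ _ xin) := allP ok b bin; rewrite eqxx => /allP/(_ L).
rewrite mem_filter gen Lin => /(_ isT)/allP/(_ virt vin).
by rewrite /= wf.
Qed.

Definition sgn_of (R : realType) (x : R) : sgn :=
  (if x == 0 then None else Some (0 < x))%R.

Lemma mem_sgn_vectors l : l \in sgn_vectors (size l).
Proof.
elim: l => [|x l IH] //; rewrite -[sgn_vectors _]/[seq y :: v |
  y <- [:: None; Some true; Some false], v <- sgn_vectors (size l)].
apply/allpairsP; exists (x, l); split=> //.
by case: x => [[]|].
Qed.

Lemma at5_map (f : nat -> sgn) k : (forall k, f (k %% 5) = f k) ->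
  at5 [seq f k | k <- iota 0 5] k = f k.
Proof.
move=> fE; rewrite /at5 (nth_map 0) ?size_iota ?ltn_pmod // nth_iota ?ltn_pmod //.
exact: fE.
Qed.

(** A list sorted by edges is the concatenation of its rows. *)
Lemma mem_arrangements (b : seq sgn) (L : seq (nat * nat)) m n :
  sorted (fun q r => q.1 <= r.1) L -> all (fun q => (m <= q.1) && (q.1 < m + n)) L ->
  (forall k, m <= k < m + n -> perm_eq [seq q <- L | q.1 == k] (edge_row b k)) ->
  L \in arrangements b (iota m n).
Proof.
elim: n m L => [|n IH] m L sL aL pL /=.
  case: L aL {sL pL} => [|q L] //= /andP[+ _]; lia.
have eL : L = [seq q <- L | q.1 == m] ++ [seq q <- L | m < q.1].
  elim: L sL aL {pL} => //= q L IHL sL /andP[qm aL].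
  have := IHL (path_sorted sL) aL; case: (ltngtP m q.1) => [lt|gt|_] eL.
  - have aq : all (fun r => m < r.1) L.
      apply/allP => r rL; apply: leq_trans lt _.
      have tr : transitive (fun q r : nat * nat => q.1 <= r.1) by move=> ? ? ?; apply: leq_trans.
      by apply: (allP (order_path_min tr sL)).
    rewrite [X in X ++ _](_ : _ = [::]).
      by rewrite /= (all_filterP aq).
    apply/eqP; rewrite -[_ == _]negbK -has_filter -all_predC.
    by apply: sub_all aq => r /=; rewrite neq_ltn orbC => ->.
  - by move: qm; lia.
  - by rewrite ?eqxx /= -eL.
rewrite {1}eL; apply/allpairsP.
exists ([seq q <- L | q.1 == m], [seq q <- L | m < q.1]); split=> //=.
  by rewrite mem_permutations pL //; lia.
apply: IH => [||k mk].
- by apply: sorted_filter sL => ? ? ?; apply: leq_trans.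
- by apply/allP => q; rewrite mem_filter => /andP[mq /(allP aL)]; lia.
- rewrite -filter_predI (eq_filter (a2 := fun q => q.1 == k)).
    by apply: pL; lia.
  by move=> q /=; case: eqP => //= ->; lia.
Qed.

Definition virtualize (w : seq passage) : seq passage :=
  [seq (label e, Virt, side e) | e <- w].

Lemma genus0_virtualize w : well_formed w -> planar w -> genus0 (virtualize w).
Proof.
move=> wfw pw; apply: planar_genus0.
apply: (@planar_map (fun e => (label e, Virt, side e)) w wfw) => //.
move=> e f ew fw [el es].
case: (well_formed_label wfw ew fw el) => // ep; move: es; rewrite ep.
by rewrite /partner {1}/side /=; case: (side f).
Qed.

Lemma virtualize_pentagon_code b w virt L :
  virtualize (pentagon_code b w virt L) = pentagon_code b [::] (nseq 5 true) L.
Proof.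
rewrite /virtualize /pentagon_code /canon -!map_comp; apply: eq_map => q /=.
rewrite /pentagon_passage /label /kind /side /=.
have -> : nth true (nseq 5 true) (crossing_index q) = true.
  by rewrite nth_nseq; case: ifP.
by congr ((index _ _), _, _).
Qed.

(** The canonical code sees only which labels are equal. *)
Lemma canon_ext (T : eqType) (L : seq T) (g g' : T -> passage) :
  {in L &, forall q r, (label (g q) == label (g r)) = (label (g' q) == label (g' r))} ->
  {in L, forall q, kind (g q) = kind (g' q) /\ side (g q) = side (g' q)} ->
  canon (map g L) = canon (map g' L).
Proof.
move=> hl hks; rewrite /canon -!map_comp; apply/eq_in_map => q qL /=.
have [-> ->] := hks q qL; congr (_, _, _).
rewrite /index !find_map; apply: eq_in_find => r rL /=.
by rewrite hl.
Qed.

Local Open Scope ring_scope.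

Section SgnOf.
Variable R : realType.
Implicit Types x y : R.

Lemma sgn_ofM x y : sgn_of (x * y) = sgn_mul (sgn_of x) (sgn_of y).
Proof.
rewrite /sgn_of mulf_eq0; case: (ltrgt0P x) => hx; case: (ltrgt0P y) => hy //=; rewrite /sgn_mul.
- by rewrite mulr_gt0.
- by rewrite pmulr_rgt0 // lt_gtF.
- by rewrite nmulr_rgt0 // lt_gtF.
- by rewrite nmulr_rgt0 ?hy.
Qed.

Lemma sgn_ofN x : sgn_of (- x) = sgn_opp (sgn_of x).
Proof. by rewrite /sgn_of oppr_eq0 oppr_gt0; case: (ltrgt0P x). Qed.

Lemma sgn_of_true x : (sgn_of x == Some true) = (0 < x).
Proof. by rewrite /sgn_of; case: (ltrgt0P x). Qed.

Lemma sgn_of_false x : (sgn_of x == Some false) = (x < 0).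
Proof. by rewrite /sgn_of; case: (ltrgt0P x). Qed.

Lemma balanced_sum (l : seq R) : \sum_(x <- l) x = 0 -> balanced (map (@sgn_of R) l).
Proof.
have pos_neg (t : seq R) : \sum_(x <- t) x = 0 ->
    has (fun x => 0 < x) t -> has (fun x => x < 0) t.
  move=> st; apply: contraLR; rewrite -!all_predC => /allP nn.
  have nn' x : x \in t -> 0 <= x by move=> /nn /=; rewrite -leNgt.
  have : \sum_(x <- t) x == 0 by rewrite st.
  rewrite big_seq psumr_eq0 => [/allP h|x /nn' //].
  by apply/allP => x xt /=; have := h x xt; rewrite xt /= => /eqP->; rewrite ltxx.
have memE (t : seq R) c :
    (Some c \in map (@sgn_of R) t) = has (fun x => sgn_of x == Some c) t.
  by rewrite -has_pred1 has_map.
move=> sl; rewrite /balanced !memE (eq_has sgn_of_true) (eq_has sgn_of_false).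
apply/eqP; apply/idP/idP; first exact: pos_neg.
have sN : \sum_(x <- map -%R l) x = 0 by rewrite big_map sumrN sl oppr0.
move=> h; have := pos_neg _ sN; rewrite !has_map.
rewrite (eq_has (a1 := preim _ _) (a2 := fun x => x < 0)); last first.
  by move=> x /=; rewrite oppr_gt0.
rewrite (eq_has (a1 := preim _ _) (a2 := fun x => 0 < x)); last first.
  by move=> x /=; rewrite oppr_lt0.
exact.
Qed.
End SgnOf.

(** * Crossings of a plane polygon *)

Section Plane.
Variable R : realType.
Implicit Types (p q r t : 'rV[R]_2).

(** Twice the oriented area of a triangle. *)
Definition det2 p q r : R := cross (q - p) (r - p).

Lemma det2E p q r : det2 p q r =
  (q 0 0 - p 0 0) * (r 0 1 - p 0 1) - (q 0 1 - p 0 1) * (r 0 0 - p 0 0).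
Proof. by rewrite /det2 /cross !mxE. Qed.

Lemma det2_rot p q r : det2 q r p = det2 p q r.
Proof. by rewrite !det2E; ring. Qed.

Lemma rv2P p q : p 0 0 = q 0 0 -> p 0 1 = q 0 1 -> p = q.
Proof.
move=> e0 e1; apply/rowP => k; case: k => [[|[|//]] hk].
  by have -> : Ordinal hk = 0 by apply: val_inj.
by have -> : Ordinal hk = 1 by apply: val_inj.
Qed.

Lemma lerpE (p q : 'rV[R]_2) x k : lerp p q x 0 k = (1 - x) * p 0 k + x * q 0 k.
Proof. by rewrite /lerp !mxE. Qed.

(** The distance to the line [p q] is affine along [r t], and it vanishes at the
common point. *)
Lemma lerp_det2 p q r t x y : lerp p q x = lerp r t y ->
  (1 - y) * det2 p q r + y * det2 p q t = 0.
Proof.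
move=> e; have := congr1 (fun u : 'rV__ => u 0 0) e.
have := congr1 (fun u : 'rV__ => u 0 1) e.
rewrite /= !lerpE !det2E => e1 e0.
have -> : (1 - y) * ((q 0 0 - p 0 0) * (r 0 1 - p 0 1) -
    (q 0 1 - p 0 1) * (r 0 0 - p 0 0)) +
  y * ((q 0 0 - p 0 0) * (t 0 1 - p 0 1) - (q 0 1 - p 0 1) * (t 0 0 - p 0 0)) =
  (q 0 0 - p 0 0) * (((1 - y) * r 0 1 + y * t 0 1) - p 0 1) -
  (q 0 1 - p 0 1) * (((1 - y) * r 0 0 + y * t 0 0) - p 0 0) by ring.
by rewrite -e0 -e1; ring.
Qed.

Lemma on_segment_end1 p q : on_segment p q p.
Proof. by exists 0; [lra | apply: rv2P; rewrite lerpE; ring]. Qed.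

Lemma collinear_lerp p q u : det2 p q u = 0 -> p != q -> exists x, u = lerp p q x.
Proof.
rewrite det2E => /eqP; rewrite subr_eq0 => /eqP du npq.
case: (eqVneq (p 0 0) (q 0 0)) => [e0|n0].
  have n1 : q 0 1 - p 0 1 != 0.
    by rewrite subr_eq0; apply: contraNneq npq => e1; rewrite (rv2P e0 (esym e1)).
  exists ((u 0 1 - p 0 1) / (q 0 1 - p 0 1)); apply: rv2P; rewrite lerpE; last by field.
  apply: (mulfI n1); move: du; rewrite e0 subrr mul0r => /esym/eqP.
  by rewrite mulf_eq0 (negbTE n1) /= subr_eq0 => /eqP ->; field.
have n0' : q 0 0 - p 0 0 != 0 by rewrite subr_eq0 eq_sym.
exists ((u 0 0 - p 0 0) / (q 0 0 - p 0 0)); apply: rv2P; rewrite lerpE; first by field.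
apply: (mulfI n0'); transitivity ((q 0 0 - p 0 0) * p 0 1 + (q 0 1 - p 0 1) * (u 0 0 - p 0 0)).
  by rewrite -du; ring.
by field.
Qed.

(** In a coordinate on the common line, either an end of the second segment lies
between those of the first one, or its ends are on both sides of the first one. *)
Lemma collinear_overlap p q r t x y : 0 < x < 1 -> 0 < y < 1 ->
  lerp p q x = lerp r t y -> p != q -> det2 p q r = 0 ->
  [\/ on_segment p q r, on_segment p q t | on_segment r t p].
Proof.
move=> hx hy e npq d1.
have d2 : det2 p q t = 0.
  have := lerp_det2 e; rewrite d1 mulr0 add0r => /eqP; rewrite mulf_eq0.
  by case/orP => /eqP // y0; lra.
have [a ea] := collinear_lerp d1 npq; have [b eb] := collinear_lerp d2 npq.
have hab : x = (1 - y) * a + y * b.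
  apply/eqP; rewrite -subr_eq0; apply: contraNT npq => nz; apply/eqP.
  have ek k : p 0 k = q 0 k.
    have := congr1 (fun u : 'rV__ => u 0 k) e; rewrite /= ea eb !lerpE => ek.
    apply: (mulfI nz); apply/eqP; rewrite -subr_eq0; apply/eqP.
    move/eqP: ek; rewrite eq_sym -subr_eq0 => /eqP <-; ring.
  by apply: rv2P.
case: (boolP (0 <= a <= 1)) => ha; first by apply: Or31; exists a.
case: (boolP (0 <= b <= 1)) => hb; first by apply: Or32; exists b.
apply: Or33; have nba : b - a != 0.
  rewrite subr_eq0; apply: contraNneq ha => eab; move: hab; rewrite eab => hab.
  have -> : a = x by rewrite hab; ring.
  by lra.
have cases : (a < 0 /\ 1 < b) \/ (b < 0 /\ 1 < a).
  have : (a < 0) || (1 < a) by move: ha; rewrite negb_and -!ltNge.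
  have : (b < 0) || (1 < b) by move: hb; rewrite negb_and -!ltNge.
  have prod_gt0 u v : 0 < u -> 0 < v -> 0 < (1 - y) * u + y * v.
    by move=> u0 v0; rewrite addr_gt0 ?mulr_gt0 //; lra.
  case/orP => h1; case/orP => h2; [|by right|by left|].
    have := prod_gt0 (- a) (- b); rewrite !mulrN -opprD -hab; lra.
  have := prod_gt0 (a - 1) (b - 1); have -> : (1 - y) * (a - 1) + y * (b - 1) = x - 1.
    by rewrite hab; ring.
  by lra.
exists (- a / (b - a)).
  case: cases => -[h1 h2].
    by rewrite divr_ge0 ?ler_pdivrMr /=; lra.
  by rewrite -mulrNN -invrN divr_ge0 ?ler_pdivrMr /=; lra.
by rewrite ea eb; apply: rv2P; rewrite !lerpE; field.
Qed.

(** Two consecutive segments with a common interior point fold over each other,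
and the shorter of the two lies on the other one. *)
Lemma consecutive_overlap p q t x y : 0 < x < 1 -> 0 < y < 1 ->
  lerp p q x = lerp q t y -> on_segment p q t \/ on_segment q t p.
Proof.
move=> hx hy e.
have ek k : (1 - x) * (p 0 k - q 0 k) = y * (t 0 k - q 0 k).
  have := congr1 (fun u : 'rV__ => u 0 k) e; rewrite /= !lerpE => ek.
  by apply/eqP; rewrite -subr_eq0; move/eqP: ek; rewrite -subr_eq0 => /eqP <-; apply/eqP; ring.
have y0 : y != 0 by apply: lt0r_neq0; lra.
have x0 : 1 - x != 0 by apply: lt0r_neq0; lra.
case: (lerP (1 - x) y) => le; [left | right].
  exists (1 - (1 - x) / y).
    by rewrite subr_ge0 ler_pdivrMr ?gerBl ?divr_ge0 /=; lra.
  have et k : t 0 k = q 0 k + (1 - x) / y * (p 0 k - q 0 k).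
    by apply: (mulfI y0); rewrite mulrDr mulrA [y * (_ / y)]mulrC divfK // ek; ring.
  by apply: rv2P; rewrite lerpE et; field.
exists (y / (1 - x)); first by rewrite ler_pdivrMr ?divr_ge0 /=; lra.
have ep k : p 0 k = q 0 k + y / (1 - x) * (t 0 k - q 0 k).
  by apply: (mulfI x0); rewrite mulrDr mulrA [(1 - x) * (_ / _)]mulrC divfK // -ek; ring.
by apply: rv2P; rewrite lerpE ep; field.
Qed.

(** The root of an affine function on the unit interval, from its end values. *)
Lemma zero_combination (A B x : R) : 0 < x < 1 -> A != 0 ->
  (1 - x) * A + x * B = 0 -> A * B < 0 /\ x = A / (A - B).
Proof.
move=> hx A0 e; have xn : x != 0 by apply: lt0r_neq0; lra.
have eB : B = - ((1 - x) / x) * A.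
  apply: (mulfI xn); move/eqP: e; rewrite addrC addr_eq0 => /eqP ->; field.
  by rewrite xn.
have pos : 0 < (1 - x) / x by rewrite divr_gt0; lra.
split.
  rewrite eB mulrCA mulNr oppr_lt0 mulr_gt0 // lt0r mulf_neq0 //=.
  by rewrite -expr2 sqr_ge0.
have -> : A - B = A / x by rewrite eB; field.
by field; rewrite xn A0.
Qed.

Lemma opposite_param (A B : R) : A * B < 0 -> 0 < A / (A - B) < 1.
Proof.
move=> AB; have n0 : A - B != 0.
  by apply: contraTneq AB => /eqP; rewrite subr_eq0 => /eqP->; rewrite -leNgt -expr2 sqr_ge0.
have A0 : A != 0 by apply: contraTneq AB => ->; rewrite mul0r ltxx.
have sq : 0 < (A - B) ^+ 2 by rewrite lt0r sqrf_eq0 n0 sqr_ge0.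
have sA : 0 < A ^+ 2 by rewrite lt0r sqrf_eq0 A0 sqr_ge0.
have -> : A / (A - B) = (A ^+ 2 - A * B) / (A - B) ^+ 2 by field.
rewrite divr_gt0 ?ltr_pdivrMr //=; last by lra.
have sB : 0 <= B ^+ 2 by rewrite sqr_ge0.
have B0 : B != 0 by apply: contraTneq AB => ->; rewrite mulr0 ltxx.
have {}sB : 0 < B ^+ 2 by rewrite lt0r sqrf_eq0 B0.
by rewrite mul1r sqrrB -mulr_natl; lra.
Qed.

End Plane.

Section Polygon.
Variables (R : realType) (n : nat) (s : n.-tuple 'rV[R]_2).
Hypotheses (n_ge3 : (3 <= n)%N) (gp : general_position s).

Local Notation P := (tnth s).

(** Proportional to the signed distance of the vertex [j] from the line of the
edge [i]. *)
Definition edge_det (i j : 'I_n) : R := det2 (P i) (P (ordS i)) (P j).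

Definition meets (i j : 'I_n) : bool :=
  (edge_det i j * edge_det i (ordS j) < 0) && (edge_det j i * edge_det j (ordS i) < 0).

(** The place on the edge [i] where the line of the edge [j] crosses it. *)
Definition param (i j : 'I_n) : R :=
  edge_det j i / (edge_det j i - edge_det j (ordS i)).

Lemma ordS_neq (i : 'I_n) : ordS i != i.
Proof.
rewrite -val_eqE /=; have hi := ltn_ord i.
case: (ltnP i.+1 n) => h; first by rewrite modn_small //; lia.
have -> : i.+1 = n by lia.
by rewrite modnn; lia.
Qed.

Lemma ordSS_neq (i : 'I_n) : ordS (ordS i) != i.
Proof.
rewrite -val_eqE /= -addn1 modnDml addn1; have hi := ltn_ord i.
case: (ltnP i.+2 n) => h; first by rewrite modn_small //; lia.
have -> : i.+2 = (i.+2 - n + n)%N by lia.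
by rewrite modnDr modn_small; lia.
Qed.

Lemma edge_neq (i : 'I_n) : P i != P (ordS i).
Proof.
apply/eqP => e; apply: (gp.1 (ordS i) i).
- by rewrite eq_sym ordS_neq.
- by rewrite eq_sym ordSS_neq.
- by rewrite e; apply: on_segment_end1.
Qed.

Lemma crossing_sym a b : crossing s a b -> crossing s b a.
Proof. by case=> ne ha hb e; split; rewrite // eq_sym. Qed.

(** Adjacent edges do not cross in general position, as one of them would fold
back over the other. *)
Lemma crossing_not_next a b : crossing s a b -> b.1 != ordS a.1.
Proof.
case: a b => i x [j y] [/= _ hx hy e]; apply/eqP => ej; move: e; rewrite /point_at /= ej => e.
have [h|h] := consecutive_overlap hx hy e.
  by apply: (gp.1 i _ _ _ h); rewrite ?ordSS_neq // (inj_eq (can_inj (@ordSK _))) ordS_neq.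
by apply: (gp.1 (ordS i) _ _ _ h); rewrite eq_sym ?ordSS_neq ?ordS_neq.
Qed.

(** Otherwise the two edges would lie on one line and overlap. *)
Lemma crossing_det_neq0 a b : crossing s a b -> edge_det a.1 b.1 != 0.
Proof.
move=> c; have := crossing_not_next c; have := crossing_not_next (crossing_sym c).
case: a b c => i x [j y] [/= nij hx hy e] ni nj; apply/eqP => d0.
case: (collinear_overlap hx hy e (edge_neq i) d0) => h.
- by apply: (gp.1 i j _ _ h); rewrite // eq_sym.
- apply: (gp.1 i (ordS j) _ _ h); first by rewrite eq_sym.
  by rewrite (inj_eq (can_inj (@ordSK _))) eq_sym.
- by apply: (gp.1 j i _ _ h).
Qed.

(** In general position all crossings are transversal, so they are decided by
signs, and the lines determine where they are. *)
Lemma crossingP a b : crossing s a b <->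
  [/\ meets a.1 b.1, a.2 = param a.1 b.1 & b.2 = param b.1 a.1].
Proof.
have half c d : crossing s c d ->
    edge_det d.1 c.1 * edge_det d.1 (ordS c.1) < 0 /\ c.2 = param c.1 d.1.
  move=> cr; have := crossing_det_neq0 (crossing_sym cr).
  case: c d cr => i x [j y] [/= _ hx hy e] d0.
  exact: (zero_combination hx d0 (lerp_det2 (esym e))).
split=> [c|].
  have [h1 e1] := half _ _ c; have [h2 e2] := half _ _ (crossing_sym c).
  by split; rewrite // /meets h1 h2.
case: a b => i x [j y] /= [/andP[hij hji] -> ->]; split=> /=.
- apply: contraTneq hij => ->.
  by rewrite /edge_det /det2 subrr /cross !mxE !mulr0 subrr mul0r ltxx.
- exact: opposite_param.
- exact: opposite_param.
- rewrite /point_at /param /=.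
  have n1 : edge_det j i - edge_det j (ordS i) != 0.
    apply: contraTneq hji => /eqP; rewrite subr_eq0 => /eqP->.
    by rewrite -leNgt -expr2 sqr_ge0.
  have n2 : edge_det i j - edge_det i (ordS j) != 0.
    apply: contraTneq hij => /eqP; rewrite subr_eq0 => /eqP->.
    by rewrite -leNgt -expr2 sqr_ge0.
  have e12 : edge_det j i - edge_det j (ordS i) = - (edge_det i j - edge_det i (ordS j)).
    by rewrite /edge_det !det2E; ring.
  rewrite e12 in n1 *; apply: rv2P; rewrite !lerpE.
  + apply: (mulfI n2); move: n2; set d := edge_det i j - _ => n2.
    transitivity (d * P i 0 0 - edge_det j i * (P (ordS i) 0 0 - P i 0 0)); first by field.
    transitivity (d * P j 0 0 + edge_det i j * (P (ordS j) 0 0 - P j 0 0)); last by field.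
    by rewrite /d /edge_det !det2E; ring.
  + apply: (mulfI n2); move: n2; set d := edge_det i j - _ => n2.
    transitivity (d * P i 0 1 - edge_det j i * (P (ordS i) 0 1 - P i 0 1)); first by field.
    transitivity (d * P j 0 1 + edge_det i j * (P (ordS j) 0 1 - P j 0 1)); last by field.
    by rewrite /d /edge_det !det2E; ring.
Qed.

Lemma meets_sym i j : meets i j = meets j i.
Proof. by rewrite /meets andbC. Qed.

Lemma meets_crossing i j : meets i j -> crossing s (i, param i j) (j, param j i).
Proof. by move=> m; apply/crossingP. Qed.

(** No three edges pass through one point, so a point of an edge lies on at
most one other edge. *)
Lemma param_inj i j k : meets i j -> meets i k -> param i j = param i k -> j = k.
Proof.
move=> mj mk e; have [/= nij hx hy ej] := meets_crossing mj.
have [/= nik _ hz ek] := meets_crossing mk.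
apply/eqP; apply: contraT => njk; exfalso; apply: (gp.2 i j k).
  by rewrite /= !inE negb_or nij nik njk.
exists (point_at s (i, param i j)); split.
- by exists (param i j); [case/andP: hx => *; apply/andP; split; apply: ltW | ].
- by rewrite ej; exists (param j i); [case/andP: hy => *; apply/andP; split; apply: ltW | ].
- by rewrite e ek; exists (param k i); [case/andP: hz => *; apply/andP; split; apply: ltW | ].
Qed.

Lemma cross_direction i j :
  cross (direction s i) (direction s j) = edge_det i (ordS j) - edge_det i j.
Proof. by rewrite /edge_det !det2E /cross /direction !mxE; ring. Qed.

End Polygon.

(** * From polygons to codes *)

Lemma before_trans (R : realType) n : transitive (@before R n).
Proof.
move=> [j y] [i x] [k z]; rewrite /before /=.
case/orP => [h1|/andP[/eqP -> h1]]; case/orP => [h2|/andP[/eqP e2 h2]].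
- by rewrite (ltn_trans h1 h2).
- by rewrite -e2 h1.
- by rewrite h2.
- by rewrite e2 eqxx (lt_trans h1 h2) orbT.
Qed.

Lemma before_irr (R : realType) n : irreflexive (@before R n).
Proof. by case=> i x; rewrite /before /= ltnn eqxx ltxx. Qed.

Lemma map_nth_index (S T : eqType) (y0 : T) (s : seq S) (t : seq T) :
  uniq s -> size t = size s -> map (fun x => nth y0 t (index x s)) s = t.
Proof.
case: s => [|x0 s] us sz; first by case: t sz.
apply: (@eq_from_nth _ y0); rewrite size_map // => k hk.
by rewrite (nth_map x0) // index_uniq.
Qed.

Section DiagramOf.
Variables (R : realType) (n : nat) (F : 'M[R]_3) (v : n.-tuple 'rV[R]_3).
Local Notation s := (shadow F v).
Hypotheses (n_ge3 : (3 <= n)%N) (gp : general_position s).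

(** The position of the crossing of the edges of [q], on the first edge. *)
Definition place (q : 'I_n * 'I_n) : 'I_n * R := (q.1, param s q.1 q.2).

Lemma place_inj q r : meets s q.1 q.2 -> meets s r.1 r.2 -> place q = place r -> q = r.
Proof.
case: q r => i j [k l] /= mq mr [e1]; subst k => e2.
by have <- : j = l := param_inj n_ge3 gp mq mr e2.
Qed.

Lemma place_crossing q r : meets s q.1 q.2 -> meets s r.1 r.2 ->
  (crossing s (place q) (place r) <-> r = (q.2, q.1)).
Proof.
move=> mq mr; split=> [/(crossingP n_ge3 gp)[/= m e1 e2]|->]; last first.
  by apply/(crossingP n_ge3 gp).
have e12 := param_inj n_ge3 gp mq m e1.
have e21 := param_inj n_ge3 gp mr (etrans (meets_sym _ _ _) m) e2.
by case: r {mr m e1 e2} e12 e21 => k l /= -> ->.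
Qed.

(** Everything in the diagram of a polygon is determined by the pairs of edges
that meet: a double point amounts to such a pair and a passage to an ordering of
it.  Only the order of the passages along one edge is not recorded. *)
Lemma diagram_of_code D : diagram_of F v D ->
  exists (L : seq ('I_n * 'I_n)) (g : 'I_n * 'I_n -> passage),
  [/\ code D = map g L, uniq L, sorted (fun q r : 'I_n * 'I_n => (q.1 <= r.1)%N) L
    & forall q, (q \in L) = meets s q.1 q.2] /\
  {in L &, forall q r,
     (label (g q) = label (g r) <-> q = r \/ r = (q.2, q.1)) /\
     (r = (q.2, q.1) ->
       side (g q) = (0 < cross (direction s q.1) (direction s r.1)) /\
       ((kind (g q) = Virt /\ kind (g r) = Virt) \/
        kind (g q) = if height F (point_at v (place r)) < height F (point_at v (place q))
                     then Over else Under))}.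
Proof.
move=> [[ps [ps_sorted ps_mem ps_size ps_rel]] _].
(* No three edges are concurrent, so the other edge is unique. *)
pose edges (a : 'I_n * R) : 'I_n * 'I_n :=
  (a.1, odflt a.1 [pick j | meets s a.1 j && (a.2 == param s a.1 j)]).
have edgesK : {in ps, cancel edges place} /\ {in ps, forall a, meets s (edges a).1 (edges a).2}.
  suff h a : a \in ps -> place (edges a) = a /\ meets s (edges a).1 (edges a).2.
    by split=> a /h[].
  move=> /ps_mem[b /(crossingP n_ge3 gp)[m e _]]; rewrite /place /edges /=.
  case: pickP => [j /andP[mj /eqP ej]|/(_ b.1)]; last by rewrite m e eqxx.
  by split; rewrite /= -?ej -?surjective_pairing.
have [{}edgesK edges_meet] := edgesK.
pose L := map edges ps.
have ps_uniq : uniq ps := sorted_uniq (@before_trans R n) (@before_irr R n) ps_sorted.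
have L_uniq : uniq L by rewrite map_inj_in_uniq //; apply: can_in_inj edgesK.
have psE : ps = map place L.
  by rewrite -map_comp -[LHS]map_id; apply/eq_in_map => a ha /=; rewrite edgesK.
have L_mem q : (q \in L) = meets s q.1 q.2.
  apply/mapP/idP => [[a ha ->]|m]; first exact: edges_meet.
  have hp : place q \in ps.
    by apply/ps_mem; exists (place (q.2, q.1)); apply/(crossingP n_ge3 gp).
  exists (place q) => //; have := edges_meet _ hp; have := edgesK _ hp.
  rewrite /edges /place /=; case: pickP => [j _|/(_ q.2)]; last by rewrite m eqxx.
  move=> /= [e] mj; rewrite (param_inj n_ge3 gp mj m e).
  by case: (q).
pose e0 : passage := (0%N, Virt, false).
pose g q := nth e0 (code D) (index q L).
have sz : size (code D) = size L by rewrite -ps_size size_map.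
have codeE : code D = map g L by rewrite map_nth_index.
exists L, g; split.
  split=> //; rewrite sorted_map; apply: sub_sorted ps_sorted.
  by move=> [i x] [j y]; rewrite /before /= => /orP[/ltnW|/andP[/eqP->]].
have in_zip q : q \in L -> (place q, g q) \in zip ps (code D).
  move=> qL; rewrite psE codeE.
  by elim: (L) qL => //= q' L' IH; rewrite !inE => /orP[/eqP->|/IH->]; rewrite ?eqxx ?orbT.
move=> q r qL rL; have [lab cr] := ps_rel _ _ _ _ (in_zip _ qL) (in_zip _ rL).
have mq : meets s q.1 q.2 by rewrite -L_mem.
have mr : meets s r.1 r.2 by rewrite -L_mem.
split; last by move=> er; apply: cr; apply/place_crossing.
rewrite lab (place_crossing mq mr); split=> -[e|e]; [left | by right | left | by right].
  exact: place_inj mq mr e.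
by rewrite e.
Qed.

(** Conversely, a polygon has a diagram of this form. *)
Lemma diagram_of_map (L : seq ('I_n * 'I_n)) (g : 'I_n * 'I_n -> passage) o :
  sorted (@before R n) (map place L) -> (forall q, (q \in L) = meets s q.1 q.2) ->
  {in L &, forall q r, label (g q) = label (g r) <-> q = r \/ r = (q.2, q.1)} ->
  {in L, forall q, let r := (q.2, q.1) in
     side (g q) = (0 < cross (direction s q.1) (direction s r.1)) /\
     ((kind (g q) = Virt /\ kind (g r) = Virt) \/
      kind (g q) = if height F (point_at v (place r)) < height F (point_at v (place q))
                   then Over else Under)} ->
  (exists i0 : 'I_n, [/\ val i0 = 0%N,
     exists u : 'rV[R]_2, forall i : 'I_n, i != i0 ->
       dot u (tnth s i) < dot u (tnth s i0)
   & o = (cross (direction s (ord_pred i0)) (direction s i0) < 0)]) ->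
  diagram_of F v (Diagram o (map g L)).
Proof.
move=> L_sorted L_mem lab cr base; split; last exact: base.
exists (map place L); split=> //=.
- move=> a; split=> [/mapP[q qL ->]|[b /(crossingP n_ge3 gp)[m e1 e2]]].
    exists (place (q.2, q.1)); apply/(crossingP n_ge3 gp).
    by split; rewrite // -L_mem; case: (q) qL.
  apply/mapP; exists (a.1, b.1); first by rewrite L_mem.
  by rewrite /place /= -e1 -surjective_pairing.
- by rewrite !size_map.
have zipE : zip (map place L) (map g L) = [seq (place q, g q) | q <- L].
  by elim: (L) => //= q l ->.
rewrite zipE => a e b f /mapP[q qL [-> ->]] /mapP[r rL [-> ->]].
have mq : meets s q.1 q.2 by rewrite -L_mem.
have mr : meets s r.1 r.2 by rewrite -L_mem.
rewrite lab // (place_crossing mq mr); split=> [|->]; last exact: cr.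
by split=> -[e'|e']; [left; rewrite e'|right|left; apply: place_inj e'|right].
Qed.

End DiagramOf.

(** * The signs of a pentagon *)

Lemma height_point_at (R : realType) n (F : 'M[R]_3) (v : n.-tuple 'rV[R]_3) i x :
  height F (point_at v (i, x)) =
  (1 - x) * height F (tnth v i) + x * height F (tnth v (ordS i)).
Proof. by rewrite /height /point_at /lerp mulmxDl -!scalemxAl !mxE. Qed.

Section Pentagon.
Variables (R : realType) (F : 'M[R]_3) (v : 5.-tuple 'rV[R]_3) (D : diagram).
Local Notation s := (shadow F v).
Hypotheses (gp : general_position s) (vD : diagram_of F v D).
Let n3 : (3 <= 5)%N := isT.

Definition pt (k : nat) : 'rV[R]_2 := nth 0 s (k %% 5).
Definition ht (k : nat) : R := height F (nth 0 v (k %% 5)).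

Definition turn (k : nat) : R := det2 (pt k) (pt (k + 1)) (pt (k + 2)).
Definition skip (k : nat) : R := det2 (pt k) (pt (k + 1)) (pt (k + 3)).

(** The oriented volume spanned by the edges [k] and [k + 2] in space. *)
Definition volume (k : nat) : R :=
  ht (k + 1) * det2 (pt k) (pt (k + 2)) (pt (k + 3))
  - ht k * det2 (pt (k + 1)) (pt (k + 2)) (pt (k + 3))
  + ht (k + 3) * turn k - ht (k + 2) * skip k.

(** Removes 5 from a literal, so that equal indices modulo 5 become syntactically
equal. *)
Lemma ptS k j : pt (k + j.+4.+1) = pt (k + j).
Proof. by rewrite /pt -[j.+4.+1]/(5 + j)%N addnCA modnDl. Qed.

Lemma htS k j : ht (k + j.+4.+1) = ht (k + j).
Proof. by rewrite /ht -[j.+4.+1]/(5 + j)%N addnCA modnDl. Qed.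

Lemma pt_mod k : pt (k %% 5) = pt k.
Proof. by rewrite /pt modn_mod. Qed.

Lemma pt_modD k j : pt (k %% 5 + j) = pt (k + j).
Proof. by rewrite /pt modnDml. Qed.

Lemma ht_modD k j : ht (k %% 5 + j) = ht (k + j).
Proof. by rewrite /ht modnDml. Qed.

Lemma turn_mod k : turn (k %% 5) = turn k.
Proof. by rewrite /turn pt_mod !pt_modD. Qed.

Lemma skip_mod k : skip (k %% 5) = skip k.
Proof. by rewrite /skip pt_mod !pt_modD. Qed.

Lemma volume_mod k : volume (k %% 5) = volume k.
Proof.
rewrite /volume turn_mod skip_mod pt_mod !pt_modD !ht_modD.
by rewrite -{1}(addn0 (k %% 5)%N) ht_modD addn0.
Qed.

Definition turn_signs := [seq sgn_of (turn k) | k <- iota 0 5].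
Definition skip_signs := [seq sgn_of (skip k) | k <- iota 0 5].
Definition volume_signs := [seq sgn_of (volume k) | k <- iota 0 5].

Lemma at5_turn k : at5 turn_signs k = sgn_of (turn k).
Proof. by apply: (at5_map (f := fun k => sgn_of (turn k))) => j; rewrite turn_mod. Qed.

Lemma at5_skip k : at5 skip_signs k = sgn_of (skip k).
Proof. by apply: (at5_map (f := fun k => sgn_of (skip k))) => j; rewrite skip_mod. Qed.

Lemma at5_volume k : at5 volume_signs k = sgn_of (volume k).
Proof. by apply: (at5_map (f := fun k => sgn_of (volume k))) => j; rewrite volume_mod. Qed.

Lemma balanced3 (x y z : R) : x + y + z = 0 ->
  balanced [:: sgn_of x; sgn_of y; sgn_of z].
Proof.
by move=> e; apply: (@balanced_sum _ [:: x; y; z]); rewrite !big_cons big_nil addr0 addrA.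
Qed.

Lemma area_signs k : area_rel turn_signs skip_signs k.
Proof.
rewrite /area_rel !at5_turn !at5_skip -!sgn_ofN.
apply: (@balanced_sum _ [:: turn (k + 1); skip k; - turn k; - skip (k + 2)]).
rewrite !big_cons big_nil /turn /skip -!addnA /= !ptS addn0 !det2E; ring.
Qed.

Lemma volume_signs_balanced : balanced volume_signs.
Proof.
rewrite /volume_signs (map_comp (@sgn_of R) volume); apply: balanced_sum.
rewrite big_map /= !big_cons big_nil /volume /turn /skip /=.
rewrite -![pt (S _)]/(pt (0 + _)) -![ht (S _)]/(ht (0 + _)).
rewrite ![pt (0 + _.+4.+1)]ptS ![ht (0 + _.+4.+1)]htS /= !det2E.
ring.
Qed.

Lemma edge_signs k : edge_rel turn_signs skip_signs volume_signs k.
Proof.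
rewrite /edge_rel !at5_turn !at5_skip !at5_volume -!sgn_ofM.
apply: balanced3; rewrite /volume /turn /skip -!addnA /= !ptS !htS !addn0 !det2E; ring.
Qed.

Lemma diagonal_signs k : diagonal_rel turn_signs skip_signs volume_signs k.
Proof.
rewrite /diagonal_rel !at5_turn !at5_skip !at5_volume -!sgn_ofM -sgn_ofN.
apply: balanced3; rewrite /volume /turn /skip -!addnA /= !ptS !htS !addn0 !det2E; ring.
Qed.

Lemma pt_ord (i : 'I_5) : tnth s i = pt i.
Proof. by rewrite (tnth_nth 0) /pt modn_small. Qed.

Lemma pt_ordS (i : 'I_5) : tnth s (ordS i) = pt (i + 1).
Proof. by rewrite (tnth_nth 0) /pt /= addn1. Qed.

Lemma ht_ord (i : 'I_5) : height F (tnth v i) = ht i.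
Proof. by rewrite (tnth_nth 0) /ht modn_small. Qed.

Lemma ht_ordS (i : 'I_5) : height F (tnth v (ordS i)) = ht (i + 1).
Proof. by rewrite (tnth_nth 0) /ht /= addn1. Qed.

Lemma outer_left_turn : outer_left D = (sgn_of (turn 4) == Some false).
Proof.
have [_ [i0 [i00 _ ->]]] := vD; rewrite sgn_of_false cross_direction.
rewrite /edge_det ord_predK pt_ordS !pt_ord i00 /=.
have -> : ((i0 + 5).-1 %% 5 = 4)%N by rewrite (i00 : i0 = 0%N :> nat).
rewrite /turn -[(4 + 1)%N]/(0 + 5)%N -[(4 + 2)%N]/(0 + 6)%N !ptS !det2E.
by congr (_ < 0); ring.
Qed.

(** In the direction where the base vertex is farthest, a combination of the
vectors to the vertices 1, 2 and 3 with coefficients of one sign does not vanish,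
but the one given by the areas at the base vertex does. *)
Lemma extreme_signs : extreme_rel turn_signs skip_signs.
Proof.
have [_ [i0 [i00 [u hu] _]]] := vD.
have lt k : (0 < k < 5)%N -> dot u (pt k) < dot u (pt 0).
  case/andP => k0 k5; have := hu (Ordinal k5); rewrite !pt_ord /= i00; apply.
  by rewrite -val_eqE /= i00 -lt0n.
have dotE q : dot u q = u 0 0 * q 0 0 + u 0 1 * q 0 1.
  by rewrite /dot !big_ord_recl big_ord0 addr0; congr (_ * q 0 _ + u 0 _ * q 0 _); apply: val_inj.
pose y k := dot u (pt 0) - dot u (pt k).
have y0 k : (0 < k < 5)%N -> sgn_of (y k) = Some true.
  by move=> /lt h; apply/eqP; rewrite sgn_of_true subr_gt0.
have : y 1 * skip 2 + y 2 * - skip 0 + y 3 * turn 0 = 0.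
  by rewrite /y !dotE /skip /turn /= -[(2 + 3)%N]/(0 + 5)%N !ptS !addn0 !det2E; ring.
move/balanced3; rewrite !sgn_ofM !y0 // /extreme_rel !at5_skip !at5_turn sgn_ofN.
by case: (sgn_of (skip 2)) (sgn_of (skip 0)) (sgn_of (turn 0)) => [[]|] [[]|] [[]|].
Qed.

Definition edges_cross (k : nat) : bool := crosses turn_signs skip_signs k.

Lemma edges_crossE k :
  edges_cross k = (turn k * skip k < 0) && (skip (k + 2) * turn (k + 1) < 0).
Proof.
rewrite /edges_cross /crosses !at5_turn !at5_skip -!sgn_ofM !sgn_of_false.
by case: ifP.
Qed.

Lemma edges_cross_sgn k : edges_cross k -> sgn_of (skip k) != None.
Proof.
rewrite edges_crossE /sgn_of; case: (skip k =P 0) => // ->.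
by rewrite mulr0 ltxx.
Qed.

(** The four determinants that decide the crossing are turns and skips. *)
Lemma meets_next2 (i j : 'I_5) : val j = ((i + 2) %% 5)%N ->
  meets s i j = edges_cross i.
Proof.
move=> ej; rewrite edges_crossE /meets /edge_det !pt_ordS !pt_ord ej pt_mod pt_modD.
rewrite /turn /skip -!addnA /= ptS addn0.
by congr ((_ < 0) && (_ * _ < 0)); rewrite det2_rot.
Qed.

Lemma meets_edges (i j : 'I_5) : meets s i j =
  if first_edge (val i, val j) then edges_cross i
  else if first_edge (val j, val i) then edges_cross j else false.
Proof.
rewrite /first_edge /=; case: eqP => [e|ne1]; first exact: meets_next2.
case: eqP => [e|ne2]; first by rewrite meets_sym meets_next2.
apply/negP => /(meets_crossing n3 gp) c.
have := crossing_not_next n3 gp c; have := crossing_not_next n3 gp (crossing_sym c).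
have [/= + _ _ _] := c; move: ne1 ne2 {c} => /=.
case: i j => [[|[|[|[|[|//]]]]] hi] [[|[|[|[|[|//]]]]] hj] //=.
all: by rewrite -?val_eqE.
Qed.

(** The volume spanned by two segments is the product of the area spanned by
their projections and the difference of their heights at the crossing. *)
Lemma volume_height (i j : 'I_5) : val j = ((i + 2) %% 5)%N -> meets s i j ->
  cross (direction s i) (direction s j) *
    (height F (point_at v (place F v (i, j))) - height F (point_at v (place F v (j, i))))
  = volume i.
Proof.
move=> ej /andP[mij mji]; rewrite /place !height_point_at cross_direction /param /=.
have n1 : edge_det s j i - edge_det s j (ordS i) != 0.
  by apply: contraTneq mji => /eqP; rewrite subr_eq0 => /eqP->; rewrite -leNgt -expr2 sqr_ge0.
have e12 : edge_det s i (ordS j) - edge_det s i j = edge_det s j i - edge_det s j (ordS i).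
  by rewrite /edge_det !det2E; ring.
have e21 : edge_det s i j - edge_det s i (ordS j) = - (edge_det s j i - edge_det s j (ordS i)).
  by rewrite -e12; ring.
rewrite e21 e12; transitivity (edge_det s j i * height F (tnth v (ordS i))
  - edge_det s j (ordS i) * height F (tnth v i)
  - edge_det s i (ordS j) * height F (tnth v j) + edge_det s i j * height F (tnth v (ordS j))).
  move: n1 e12; set X := edge_det s j i - _ => n1 e12.
  have -> : edge_det s i (ordS j) = X + edge_det s i j by rewrite -e12; ring.
  have -> : edge_det s j (ordS i) = edge_det s j i - X by rewrite /X; ring.
  by field.
rewrite /edge_det !pt_ordS !pt_ord !ht_ordS !ht_ord ej !pt_modD !pt_mod.
have -> : ht ((i + 2) %% 5) = ht (i + 2) by rewrite /ht modn_mod.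
rewrite ht_modD /volume /turn /skip -!addnA /= !det2E; ring.
Qed.

Lemma first_edge_asym (i j : nat) : (i < 5)%N -> first_edge (i, j) ->
  ~~ first_edge (j, i).
Proof. by rewrite /first_edge /=; lia. Qed.

Lemma crossing_index_eq (q r : nat * nat) :
  (q.1 < 5)%N -> (q.2 < 5)%N -> (r.1 < 5)%N -> (r.2 < 5)%N ->
  first_edge q || first_edge (q.2, q.1) -> first_edge r || first_edge (r.2, r.1) ->
  (crossing_index q == crossing_index r) = (q == r) || (r == (q.2, q.1)).
Proof.
case: q r => [i j] [k l]; rewrite /crossing_index /first_edge /= !xpair_eqE => hi hj hk hl.
by case: (j =P _) => e1; case: (l =P _) => e2 /= h1 h2; apply/idP/idP; lia.
Qed.

(** Which of two crossing edges is above, read off from the volume. *)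
Lemma sgn_of_height (X V hq hr : R) : X != 0 -> X * (hq - hr) = V ->
  (sgn_of V == Some (0 < X)) = (hr < hq).
Proof.
move=> X0 <-; case: (ltrgt0P X) X0 => // hX _.
  by rewrite sgn_of_true pmulr_rgt0 // subr_gt0.
by rewrite sgn_of_false nmulr_rlt0 // subr_gt0.
Qed.

(** What a passage depends on, for either order of the two edges: exchanging them
reverses [X] and the difference of heights, but not the volume. *)
Lemma meets_data (q : 'I_5 * 'I_5) :
  let k := crossing_index (val q.1, val q.2) in
  let X := cross (direction s q.1) (direction s q.2) in
  meets s q.1 q.2 ->
  [/\ X != 0, edges_cross k,
      X * (height F (point_at v (place F v q)) -
           height F (point_at v (place F v (q.2, q.1)))) = volume k
    & ((0 < skip k) == first_edge (val q.1, val q.2)) = (0 < X)].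
Proof.
have next2 (i j : 'I_5) : val j = ((i + 2) %% 5)%N -> meets s i j ->
    cross (direction s i) (direction s j) != 0 /\
    (0 < skip i) = (0 < cross (direction s i) (direction s j)).
  move=> ej m; have := m; rewrite (meets_next2 ej) edges_crossE => /andP[ts _].
  rewrite cross_direction /edge_det !pt_ordS !pt_ord ej pt_mod pt_modD -!addnA /=.
  rewrite -/(turn i) -/(skip i); move: ts.
  case: (ltrgt0P (skip i)) => [hs|hs|->]; last by rewrite mulr0 ltxx.
    rewrite pmulr_llt0 // => ht; have hX := lt_trans ht hs.
    by rewrite subr_eq0 gt_eqF // subr_gt0 hX.
  rewrite nmulr_llt0 // => ht; have hX := lt_trans hs ht.
  by rewrite subr_eq0 lt_eqF // subr_gt0 (lt_gtF hX).
case: q => i j /= m; rewrite /crossing_index; case: ifP => e /=.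
  have ej := eqP e; have [X0 sX] := next2 i j ej m; split=> //.
  - by rewrite -(meets_next2 ej).
  - exact: volume_height.
  - by rewrite sX; case: (0 < _).
have ei : val i = ((j + 2) %% 5)%N.
  move: m; rewrite meets_edges e; case: ifP => // /eqP //.
have m' : meets s j i by rewrite meets_sym.
have crossN : cross (direction s i) (direction s j) = - cross (direction s j) (direction s i).
  by rewrite /cross; ring.
have [X0 sX] := next2 j i ei m'; rewrite crossN; split.
- by rewrite oppr_eq0.
- by rewrite -(meets_next2 ei).
- by rewrite -(volume_height ei m'); ring.
- by rewrite sX oppr_gt0; case: (ltrgt0P (cross _ _)) X0.
Qed.

Definition skip_out : seq sgn :=
  [seq if edges_cross k then sgn_of (skip k) else None | k <- iota 0 5].

Definition volume_out : seq sgn :=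
  [seq if edges_cross k then sgn_of (volume k) else None | k <- iota 0 5].

Lemma nth_map_iota5 (T : Type) (x0 : T) (f : nat -> T) k : (k < 5)%N ->
  nth x0 [seq f i | i <- iota 0 5] k = f k.
Proof. by move=> hk; rewrite (nth_map 0%N) ?size_iota // nth_iota. Qed.

Lemma outcome_mem : (3 <= count edges_cross (iota 0 5))%N ->
  (skip_out, volume_out, outer_left D) \in outcomes.
Proof.
move=> c3; rewrite mem_undup; apply/flatten_mapP; exists turn_signs.
  exact: (mem_sgn_vectors turn_signs).
apply/flatten_mapP; exists skip_signs.
  exact: (mem_sgn_vectors skip_signs).
have -> : plane_rels turn_signs skip_signs.
  have ar : all (area_rel turn_signs skip_signs) (iota 0 5).
    by apply/allP => k _; apply: area_signs.
  by rewrite /plane_rels ltnNge c3 ar extreme_signs.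
apply/mapP; exists volume_signs.
  rewrite mem_filter (mem_sgn_vectors volume_signs) andbT.
  have er : all (edge_rel turn_signs skip_signs volume_signs) (iota 0 5).
    by apply/allP => k _; apply: edge_signs.
  have dr : all (diagonal_rel turn_signs skip_signs volume_signs) (iota 0 5).
    by apply/allP => k _; apply: diagonal_signs.
  by rewrite /space_rels volume_signs_balanced er dr.
rewrite /outcome outer_left_turn at5_turn; congr (_, _, _).
all: by apply: eq_map => k; rewrite ?at5_skip ?at5_volume.
Qed.

(** The code of the diagram is [pentagon_code] of its signs, for some order of
the passages along the edges and some choice of virtual crossings, and all these
codes have been tested. *)
Lemma pentagon_standard : plane_diagram D -> (4 < size (code D))%N ->
  exists2 M, M \in standard_forms & virtually_equivalent D M.
Proof.
move=> pD szD; have [wfD plD] := pD.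
have [L [g [[codeE Lu Ls Lm] Lrel]]] := diagram_of_code n3 gp vD.
pose pr (q : 'I_5 * 'I_5) : nat * nat := (val q.1, val q.2).
have pr_inj : injective pr by move=> [i j] [k l] [/val_inj -> /val_inj ->].
have prL q : q \in L -> first_edge (pr q) || first_edge ((pr q).2, (pr q).1).
  by rewrite Lm meets_edges; case: ifP => //= _; case: ifP.
have cross_L q : q \in L -> edges_cross (crossing_index (pr q)).
  rewrite Lm meets_edges /crossing_index /pr /=.
  by case: ifP => //= _; case: ifP.
have swapL q : q \in L -> (q.2, q.1) \in L by rewrite !Lm meets_sym.
have bs_at k : (k < 5)%N ->
    at5 skip_out k = if edges_cross k then sgn_of (skip k) else None.
  by move=> hk; rewrite /at5 modn_small // nth_map_iota5.
have ws_at k : (k < 5)%N ->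
    at5 volume_out k = if edges_cross k then sgn_of (volume k) else None.
  by move=> hk; rewrite /at5 modn_small // nth_map_iota5.
(* Each pair of crossing edges gives two passages, and there are more than 4. *)
have c3 : (3 <= count edges_cross (iota 0 5))%N.
  rewrite leqNgt; apply/negP => c2; move: szD; rewrite codeE size_map -(size_map pr) ltnNge.
  case/negP; pose U := flatten [seq [:: (k, (k + 2) %% 5); ((k + 2) %% 5, k)]%N
                                | k <- iota 0 5 & edges_cross k].
  have szU : (size U = 2 * count edges_cross (iota 0 5))%N.
    rewrite /U size_flatten /shape -map_comp -size_filter.
    by elim: (filter _ _) => //= k l ->; rewrite mulnS.
  apply: leq_trans (_ : size U <= 4)%N; last by rewrite szU; lia.
  apply: uniq_leq_size; first by rewrite map_inj_uniq.
  move=> _ /mapP[q qL ->]; apply/flatten_mapP; exists (crossing_index (pr q)).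
    rewrite mem_filter cross_L // mem_iota /crossing_index; case: ifP => _ /=; exact: ltn_ord.
  case: q qL => i j qL; move: (prL _ qL); rewrite /crossing_index /first_edge /pr /= !inE.
  by case: eqP => [-> _|_ /= /eqP ->]; rewrite eqxx ?orbT.
pose virt := [seq if edges_cross k then kind (g (inord k, inord ((k + 2) %% 5))) == Virt
                  else true | k <- iota 0 5].
have codeC : canon (code D) = pentagon_code skip_out volume_out virt (map pr L).
  rewrite codeE /pentagon_code -map_comp; apply: canon_ext => [q r qL rL|q qL].
    have [lab _] := Lrel q r qL rL.
    rewrite /= /pentagon_passage {3 4}/label /= crossing_index_eq ?ltn_ord ?prL //.
    rewrite (inj_eq pr_inj) -[((pr q).2, _)]/(pr (q.2, q.1)) (inj_eq pr_inj).
    apply/eqP/orP => [/lab[->|->]|[/eqP ->|/eqP e]]; first by left.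
    - by right.
    - by [].
    - by apply/lab; right.
  have [X0 ec eV sX] := meets_data (etrans (esym (Lm q)) qL).
  have [_ /(_ erefl)[side_q kind_q]] := Lrel q (q.2, q.1) qL (swapL q qL).
  have [_] := Lrel _ _ (swapL q qL) qL; rewrite -surjective_pairing => /(_ erefl)[_ kind_r].
  set k := crossing_index _ in ec eV sX; have k5 : (k < 5)%N.
    by rewrite /k /crossing_index; case: ifP => _; apply: ltn_ord.
  rewrite /= /pentagon_passage -[crossing_index _]/k.
  rewrite /kind /side /= -/(kind _) -/(side _) bs_at // ws_at // ec sgn_of_true sX.
  rewrite (sgn_of_height X0 eV) side_q; split=> //.
  have -> : nth true virt k = (kind (g q) == Virt).
    rewrite nth_map_iota5 // ec.
    have /orP[fe|fe] := prL q qL.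
      have [e1 e2] : k = val q.1 /\ ((k + 2) %% 5)%N = val q.2.
        by rewrite /k /crossing_index fe; split=> //; rewrite -(eqP fe).
      by rewrite e1 -e1 e2 e1 !inord_val -surjective_pairing.
    have [e1 e2] : k = val q.2 /\ ((k + 2) %% 5)%N = val q.1.
      rewrite /k /crossing_index; case: ifP => [fe'|_]; last by split=> //; rewrite -(eqP fe).
      by have := first_edge_asym (ltn_ord q.1) fe'; rewrite fe.
    rewrite e2 e1 !inord_val.
    (* The virtual crossings are read off on the first edges; both passages of a
       double point are virtual, or none. *)
    by case: kind_q kind_r => [[-> ->] //|->] [[-> ->]|->]; do 2?case: ifP.
  case: eqP => [//|nv]; case: kind_q => [[] //|->].
  by [].
have pC : plane_diagram (Diagram (outer_left D) (canon (code D))).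
  by case: (D) pD => o w; apply: plane_canon.
have [wfC plC] := pC; rewrite /= codeC in pC wfC plC.
have red : reduces_to standard_forms
    (Diagram (outer_left D) (pentagon_code skip_out volume_out virt (map pr L))).
  have ain : map pr L \in arrangements skip_out (iota 0 5).
    apply: mem_arrangements => [||k].
    + by rewrite sorted_map.
    + by apply/allP => _ /mapP[q _ ->] /=; rewrite ltn_ord.
    move=> /andP[_ k5]; pose i := Ordinal k5.
    have row_mem q : q \in edge_row skip_out k = (q.1 == k) && (q \in map pr L).
      rewrite mem_filter; apply/andP/andP => [[]|[/eqP <- /mapP[[i' j] qL ->]]].
        have ce h : (h < 5)%N -> at5 skip_out h != None -> edges_cross h.
          by move=> hh; rewrite bs_at //; case: ifP.
        have e2 : first_edge (k, ((k + 2) %% 5)%N) by rewrite /first_edge /= eqxx.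
        rewrite !inE => + /orP[]/eqP eq; rewrite eq eqxx /crossing_index.
          rewrite e2 => /(ce _ k5) c; split=> //.
          apply/mapP; exists (i, Ordinal (ltn_pmod (k + 2) (isT : 0 < 5)%N)) => //.
          by rewrite Lm meets_edges /= e2.
        have e3 : first_edge (k, ((k + 3) %% 5)%N) = false.
          by rewrite /first_edge /=; apply/eqP; lia.
        rewrite e3 /= => /(ce _ (ltn_pmod _ _)) c; split=> //.
        apply/mapP; exists (i, Ordinal (ltn_pmod (k + 3) (isT : 0 < 5)%N)) => //.
        rewrite Lm meets_edges /= e3 c // ifT // /first_edge /= modnDml -addnA.
        by rewrite modnDr modn_small.
      have := qL; rewrite Lm meets_edges /pr !inE /crossing_index /= !xpair_eqE eqxx /=.
      case: ifP => [fe ci|fe]; last case: ifP => // fe' ci.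
        by rewrite bs_at ?ltn_ord // ci edges_cross_sgn // -/(first_edge (val i', val j)) fe.
      rewrite bs_at ?ltn_ord // ci edges_cross_sgn //; split=> //; apply/orP; right.
      by move: fe'; rewrite /first_edge /=; move: (ltn_ord j) (ltn_ord i'); clear; lia.
    apply: uniq_perm => [||q]; last by rewrite row_mem mem_filter.
      by rewrite filter_uniq // map_inj_uniq.
    by rewrite filter_uniq //= mem_seq1 xpair_eqE eqxx /=; lia.
  have gen : genus0 (pentagon_code skip_out [::] (nseq 5 true) (map pr L)).
    rewrite -(virtualize_pentagon_code skip_out volume_out virt).
    exact: genus0_virtualize.
  have vin : virt \in virtual_choices skip_out.
    rewrite /virt /skip_out; elim: (iota 0 5) => // k ks IH.
    apply/allpairsP; eexists (_, _); split; [|exact: IH|by []] => /=.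
    case: ifP => // /edges_cross_sgn.
    by case: (sgn_of _) => // ? _; case: (_ == _).
  exact: outcome_reduces (outcome_mem c3) ain gen vin wfC.
have [M Ms e] := reduces_to_sound plane_standard pC red.
exists M => //; apply: rst_trans e; rewrite -codeC; case: (D) pD => o w.
exact: equivalent_canon.
Qed.

End Pentagon.

(** * Polygons with at most five edges *)

Lemma general_position_rot1 (R : realType) n (s : n.-tuple 'rV[R]_2) :
  general_position s -> general_position [tuple of rot 1 s].
Proof.
case=> g1 g2; have S_inj : injective (@ordS n) := can_inj (@ordSK n).
have tn i : tnth [tuple of rot 1 s] i = tnth s (ordS i).
  rewrite !(tnth_nth 0) /= /rot nth_cat size_drop size_tuple.
  have hi := ltn_ord i; case: ltnP => h; first by rewrite nth_drop modn_small ?add1n //; lia.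
  have -> : (i = n.-1 :> nat) by lia.
  by rewrite prednK ?modnn ?subn1 ?subnn ?nth_take //; lia.
have oe i p : on_edge [tuple of rot 1 s] i p -> on_edge s (ordS i) p by rewrite /on_edge !tn.
split=> [i j ji jSi /oe | i j k uijk [p [/oe pi /oe pj /oe pk]]].
  by rewrite tn; apply: g1; rewrite (inj_eq S_inj).
apply: (g2 (ordS i) (ordS j) (ordS k)); last by exists p.
by rewrite -(map_inj_uniq S_inj) in uijk.
Qed.

Lemma general_position_rot (R : realType) n (s : n.-tuple 'rV[R]_2) b :
  general_position s -> general_position [tuple of rot b s].
Proof.
move=> gs; elim: b => [|b IH].
  by rewrite (_ : [tuple of rot 0 s] = s) //; apply: val_inj; rewrite /= rot0.
case: (ltnP b n) => hb.
  have := general_position_rot1 IH; congr general_position.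
  by apply: val_inj; rewrite /= -rotS ?size_tuple.
rewrite (_ : [tuple of rot b.+1 s] = s) //; apply: val_inj.
by rewrite /= rot_oversize // size_tuple ltnW.
Qed.

Lemma shadow_rot (R : realType) n (F : 'M[R]_3) (v : n.-tuple 'rV[R]_3) b :
  shadow F [tuple of rot b v] = [tuple of rot b (shadow F v)].
Proof. by apply: val_inj; rewrite /= map_rot. Qed.

(** A quadrilateral has two pairs of opposite edges, and a triangle none. *)
Lemma few_edges (R : realType) n (F : 'M[R]_3) (v : n.-tuple 'rV[R]_3) D :
  (3 <= n <= 4)%N -> general_position (shadow F v) -> diagram_of F v D ->
  (size (code D) <= 4)%N.
Proof.
case/andP => n3 n4 gp vD; have [L [g [[-> uL _ Lm] _]]] := diagram_of_code n3 gp vD.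
pose pr (q : 'I_n * 'I_n) : nat * nat := (val q.1, val q.2).
have pr_inj : injective pr by move=> [i j] [k l] [/val_inj -> /val_inj ->].
rewrite size_map -(size_map pr).
apply: (@uniq_leq_size _ _ [:: (0, 2); (2, 0); (1, 3); (3, 1)]%N).
  by rewrite map_inj_uniq.
move=> _ /mapP[[i j] + ->]; rewrite Lm /pr /= => /(meets_crossing n3 gp) c.
have := crossing_not_next n3 gp c; have := crossing_not_next n3 gp (crossing_sym c).
have [/= + _ _ _] := c; rewrite -!val_eqE /=; move: (ltn_ord i) (ltn_ord j) n3 n4.
move: (val i) (val j) => i' j'; clear; rewrite !inE !xpair_eqE.
by case: n => [|[|[|[|[|//]]]]] //; do 4?[case: i' => [|i'] //]; do 4?[case: j' => [|j'] //].
Qed.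

Lemma realizable_standard (R : realType) n K : plane_diagram K -> (n <= 5)%N ->
  realizable R n K ->
  is_unknot K \/ exists2 M, M \in standard_forms & virtually_equivalent K M.
Proof.
move=> pK n5 [v [F [b [D [[n3 _ _ _] _ gp vD e]]]]].
have pD : plane_diagram D by apply/(equivalent_plane e).
have gpb : general_position (shadow F [tuple of rot b v]).
  by rewrite shadow_rot; apply: general_position_rot.
case: (leqP (size (code D)) 4) => szD.
  have [o eo] := few_crossings_unknot pD szD.
  by left; exists o; apply: rst_trans eo; apply: rst_sym.
have en : n = 5%N.
  by apply/eqP; rewrite eqn_leq n5 ltnNge; apply: contraL szD => n4;
    rewrite -leqNgt; apply: few_edges gpb vD; rewrite n3.
subst n; have [M Ms eM] := pentagon_standard gpb vD pD szD.
by right; exists M => //; apply: rst_trans eM; apply: rst_sym.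
Qed.

Lemma standard_mirror M : M \in standard_forms ->
  exists v h, mirror v h M \in basic_forms.
Proof.
case/allpairsP => -[[v h] N] [/= _ hN ->]; exists v, h.
by rewrite mirrorK.
Qed.

Lemma realizable_form (R : realType) (K : diagram) : plane_diagram K ->
     (exists2 n : nat, (n <= 5)%N & realizable R n K) ->
     up_to_mirror_images
       (fun M => [\/ is_unknot M, virtually_equivalent M knot_2_1,
                     virtually_equivalent M knot_3_5
                   | virtually_equivalent M knot_3_7]) K.
Proof.
move=> pK [n n5 /(realizable_standard pK n5)[uK|[M Ms e]]].
  by apply: Or41; apply: Or41.
apply/up_to_mirrorP; have [v [h hb]] := standard_mirror Ms; exists v, h.
have {e} := equivalent_mirror v h e; move: hb; rewrite /basic_forms /= !inE.
by case/or4P => /eqP-> e; [apply: Or41; exists true | apply: Or41; exists false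
  | apply: Or42 | apply: Or43].
Qed.

(** * Realizing knots by pentagons *)

Lemma lerp0 (R : realType) m (a b : 'rV[R]_m) : lerp a b 0 = a.
Proof. by rewrite /lerp subr0 scale1r scale0r addr0. Qed.

Lemma lerp_same (R : realType) m (a : 'rV[R]_m) x : lerp a a x = a.
Proof. by rewrite /lerp -scalerDl subrK scale1r. Qed.

Lemma proj_lerp (R : realType) (F : 'M[R]_3) (p q : 'rV[R]_3) x :
  proj F (lerp p q x) = lerp (proj F p) (proj F q) x.
Proof. by rewrite /proj /lerp mulmxDl -!scalemxAl; apply/rowP => k; rewrite !mxE. Qed.

Lemma height_lerp (R : realType) (F : 'M[R]_3) (p q : 'rV[R]_3) x :
  height F (lerp p q x) = (1 - x) * height F p + x * height F q.
Proof. by rewrite /height /lerp mulmxDl -!scalemxAl !mxE. Qed.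

Lemma lerp_collinear (R : realType) (p q : 'rV[R]_2) x : det2 p q (lerp p q x) = 0.
Proof. by rewrite det2E !lerpE; ring. Qed.

Lemma adjacent_segments (R : realType) (p q r : 'rV[R]_2) x y :
  det2 p q r != 0 -> lerp p q x = lerp q r y -> y = 0.
Proof.
move=> nd e; have := lerp_collinear p q x; rewrite e.
have -> : det2 p q (lerp q r y) = y * det2 p q r by rewrite !det2E !lerpE; ring.
by move/eqP; rewrite mulf_eq0 (negbTE nd) orbF => /eqP.
Qed.

Section Noncollinear.
Variables (R : realType) (F : 'M[R]_3) (v : 5.-tuple 'rV[R]_3).
Local Notation s := (shadow F v).
Hypothesis noncol : forall i j k : 'I_5, uniq [:: i; j; k] ->
  det2 (tnth s i) (tnth s j) (tnth s k) != 0.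
Let n3 : (3 <= 5)%N := isT.

Let ordS_inj : injective (@ordS 5) := can_inj (@ordSK 5).

Lemma edge_vertex (i j : 'I_5) : j != i -> j != ordS i -> ~ on_edge s i (tnth s j).
Proof.
move=> ji jSi [x _ e]; have : uniq [:: i; ordS i; j].
  by rewrite /= !inE negb_or eq_sym ordS_neq // eq_sym ji eq_sym jSi.
by move/noncol; rewrite e lerp_collinear eqxx.
Qed.

Lemma consecutive_det (i : 'I_5) :
  det2 (tnth s i) (tnth s (ordS i)) (tnth s (ordS (ordS i))) != 0.
Proof.
apply: noncol; rewrite /= !inE negb_or ![i == _]eq_sym ordS_neq // ordSS_neq //.
by rewrite eq_sym ordS_neq.
Qed.

Lemma consecutive_edges (i : 'I_5) p : on_edge s i p -> on_edge s (ordS i) p ->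
  p = tnth s (ordS i).
Proof.
move=> [x _ ->] [y _ e]; rewrite e.
by rewrite (adjacent_segments (consecutive_det i) e) lerp0.
Qed.

Lemma three_edges (i k : 'I_5) p : k != i -> k != ordS i ->
  on_edge s i p -> on_edge s (ordS i) p -> on_edge s k p -> False.
Proof.
move=> ki kSi pi pSi; rewrite (consecutive_edges pi pSi); apply: edge_vertex.
  by rewrite eq_sym.
by rewrite (inj_eq ordS_inj) eq_sym.
Qed.

(** Among three edges of a pentagon two are adjacent, and their common point is a
vertex. *)
Lemma noncollinear_general_position : general_position s.
Proof.
split=> [i j|i j k]; first exact: edge_vertex.
rewrite /= !inE negb_or => /and3P[/andP[ij ik] jk _] [p [pi pj pk]].
have : [|| j == ordS i, i == ordS j, k == ordS i, i == ordS k, k == ordS j | j == ordS k].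
  clear pi pj pk; move: ij ik jk; rewrite -!val_eqE /=.
  case: i j k => [[|[|[|[|[|//]]]]] hi] [[|[|[|[|[|//]]]]] hj] [[|[|[|[|[|//]]]]] hk] //=.
by case/or4P => [/eqP e|/eqP e|/eqP e|/or3P[]/eqP e]; subst;
  [apply: (three_edges _ _ pi pj pk)|apply: (three_edges _ _ pj pi pk)
  |apply: (three_edges _ _ pi pk pj)|apply: (three_edges _ _ pk pi pj)
  |apply: (three_edges _ _ pj pk pi)|apply: (three_edges _ _ pk pj pi)]; rewrite // eq_sym.
Qed.

(** Two edges with a common point in space span no volume. *)
Lemma meeting_edges_volume (i j : 'I_5) p : val j = ((i + 2) %% 5)%N ->
  on_edge v i p -> on_edge v j p -> volume F v i = 0.
Proof.
move=> ej [x _ ep] [y _ eq].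
have e := congr1 (proj F) (etrans (esym ep) eq); rewrite !proj_lerp in e.
have eh := congr1 (height F) (etrans (esym ep) eq); rewrite !height_lerp in eh.
rewrite -!(tnth_map (proj F)) -/(shadow F v) in e.
have hA := lerp_det2 e; have hC := lerp_det2 (esym e); move: hA hC.
rewrite /volume /turn /skip; rewrite !pt_ordS !pt_ord ej !pt_modD !pt_mod.
rewrite !ht_ordS !ht_ord ej !ht_modD in eh.
have ht2 : ht F v ((i + 2) %% 5) = ht F v (i + 2) by rewrite /ht modn_mod.
rewrite ht2 -!addnA /= in eh; rewrite -!addnA /=.
set p0 := pt F v i; set p1 := pt F v _; set p2 := pt F v _; set p3 := pt F v _.
set X := det2 p0 p1 p3 - det2 p0 p1 p2 => hA hC.
have eA : det2 p0 p1 p2 = - (y * X) by apply/eqP; rewrite -addr_eq0 -hA /X; apply/eqP; ring.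
have eB : det2 p0 p1 p3 = (1 - y) * X by rewrite mulrBl mul1r -eA /X; ring.
have eX : X = det2 p0 p2 p3 - det2 p1 p2 p3 by rewrite /X !det2E; ring.
have eC : det2 p0 p2 p3 = x * X.
  apply/eqP; rewrite -subr_eq0 -hC; apply/eqP; rewrite eX !det2E; ring.
have eE : det2 p1 p2 p3 = (x - 1) * X by rewrite mulrBl mul1r -eC eX; ring.
rewrite eA eB eC eE.
transitivity (X * (((1 - x) * ht F v i + x * ht F v (i + 1)) -
  ((1 - y) * ht F v (i + 2) + y * ht F v (i + 3)))); first by ring.
by rewrite eh subrr mulr0.
Qed.

Lemma noncollinear_pl_polygon : (forall k, (k < 5)%N -> volume F v k != 0) ->
  pl_polygon v.
Proof.
move=> nvol; have P_inj : injective (tnth s).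
  move=> i j e; apply/eqP; case: eqP => // /eqP ij; exfalso.
  have h k : k != i -> k != j -> False.
    move=> ki kj; have : uniq [:: i; j; k] by rewrite /= !inE negb_or ij eq_sym ki eq_sym kj.
    by move/noncol; rewrite e /det2 subrr /cross !mxE !mul0r subrr eqxx.
  case: (eqVneq (ordS i) j) => [ej|nj]; last by apply: (h (ordS i)); rewrite ?ordS_neq.
  by apply: (h (ordS j)); rewrite ?ordS_neq // -ej ordSS_neq.
have v_inj : injective (tnth v).
  by move=> i j e; apply: P_inj; rewrite !tnth_map e.
split=> // [i j k ij ik [x _ e]|i j ij p pi pj].
  case: (eqVneq j k) => [ejk|jk].
    by move: e ij; rewrite -ejk lerp_same => /v_inj ->; rewrite eqxx.
  have : uniq [:: j; k; i] by rewrite /= !inE negb_or jk ![_ == i]eq_sym ij ik.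
  by move/noncol; rewrite !tnth_map e proj_lerp lerp_collinear eqxx.
have adj (a : 'I_5) : on_edge v a p -> on_edge v (ordS a) p -> p = tnth v (ordS a).
  move=> [x _ ep] [y _ eq]; rewrite eq.
  have e := congr1 (proj F) (etrans (esym ep) eq); rewrite !proj_lerp -!(tnth_map (proj F)) in e.
  by rewrite (adjacent_segments (consecutive_det a) e) lerp0.
have : [|| j == ordS i, i == ordS j, val j == (i + 2) %% 5 | val i == (j + 2) %% 5]%N.
  clear pi pj; move: ij; rewrite -!val_eqE /=.
  by case: i j => [[|[|[|[|[|//]]]]] hi] [[|[|[|[|[|//]]]]] hj].
case/or4P => /eqP e; rewrite ?e in pi pj *.
- by exists (ordS i); apply: adj.
- by exists (ordS j); apply: adj.
- by have := nvol i (ltn_ord i); rewrite (meeting_edges_volume e pi pj) eqxx.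
- by have := nvol j (ltn_ord j); rewrite (meeting_edges_volume e pj pi) eqxx.
Qed.
End Noncollinear.

Definition pentagram_edges : seq (nat * nat) :=
  [:: (0, 2); (0, 3); (1, 3); (1, 4); (2, 4); (2, 0); (3, 0); (3, 1); (4, 1); (4, 2)]%N.

Lemma quotient_lt (R : realType) (A B A' B' : R) :
  A * B < 0 -> A' * B' < 0 -> A * A' < 0 -> A * B' < A' * B ->
  A / (A - B) < A' / (A' - B').
Proof.
move=> AB AB' AA' h.
have hd (x y : R) : x * y < 0 -> 0 < x * (x - y).
  by move=> xy; rewrite mulrBr subr_gt0 (lt_le_trans xy) // -expr2 sqr_ge0.
have d0 := hd _ _ AB; have d0' := hd _ _ AB'.
have n0 : A - B != 0 by apply: contraTneq d0 => ->; rewrite mulr0 ltxx.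
have n0' : A' - B' != 0 by apply: contraTneq d0' => ->; rewrite mulr0 ltxx.
have den : (A - B) * (A' - B') < 0.
  have : 0 < (A * A') * ((A - B) * (A' - B')).
    by rewrite mulrACA mulr_gt0.
  by rewrite nmulr_rgt0.
rewrite -subr_gt0; have -> : A' / (A' - B') - A / (A - B) =
  (A * B' - A' * B) / ((A - B) * (A' - B')) by field; rewrite n0 n0'.
by rewrite nmulr_rgt0 ?invr_lt0 // subr_lt0.
Qed.

Section Pentagram.
Variables (R : realType) (F : 'M[R]_3) (v : 5.-tuple 'rV[R]_3) (c : bool).
Local Notation s := (shadow F v).
Hypothesis gp : general_position s.
Hypothesis turn_c : forall k, sgn_of (turn F v k) = Some c.
Hypothesis skip_c : forall k, sgn_of (skip F v k) = Some (~~ c).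
Hypothesis base : exists u : 'rV[R]_2, forall k, (0 < k < 5)%N ->
  dot u (pt F v k) < dot u (pt F v 0).
Let n3 : (3 <= 5)%N := isT.

Lemma turn_skip_lt0 k l : turn F v k * skip F v l < 0.
Proof.
have := sgn_ofM (turn F v k) (skip F v l); rewrite turn_c skip_c /= => e.
by rewrite -sgn_of_false e; case: (c).
Qed.

Lemma edges_cross_all k : edges_cross F v k.
Proof. by rewrite edges_crossE [skip _ _ _ * _]mulrC !turn_skip_lt0. Qed.

(** The edge [i] crosses the edge [i + 2] first: by the three-term relation
between determinants at the vertex [i + 3], the order is decided by the sign of
[turn (i + 2) * skip i]. *)
Lemma param_lt (i j k : 'I_5) : val j = ((i + 2) %% 5)%N -> val k = ((i + 3) %% 5)%N ->
  param s i j < param s i k.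
Proof.
move=> ej ek; rewrite /param /edge_det !pt_ordS !pt_ord ej ek !pt_mod !pt_modD -!addnA /=.
have -> : det2 (pt F v (i + 2)) (pt F v (i + 3)) (pt F v i) = skip F v (i + 2).
  by rewrite /skip -!addnA /= ptS addn0.
have -> : det2 (pt F v (i + 2)) (pt F v (i + 3)) (pt F v (i + 1)) = turn F v (i + 1).
  by rewrite /turn -!addnA /= det2_rot.
have -> : det2 (pt F v (i + 3)) (pt F v (i + 4)) (pt F v i) = turn F v (i + 3).
  by rewrite /turn -!addnA /= ptS addn0.
have -> : det2 (pt F v (i + 3)) (pt F v (i + 4)) (pt F v (i + 1)) = skip F v (i + 3).
  by rewrite /skip -!addnA /= ptS.
apply: quotient_lt; rewrite ?turn_skip_lt0 // 1?[skip _ _ _ * _]mulrC ?turn_skip_lt0 //.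
rewrite -subr_lt0; suff -> : skip F v (i + 3) * skip F v (i + 2) -
  turn F v (i + 3) * turn F v (i + 1) = turn F v (i + 2) * skip F v i by apply: turn_skip_lt0.
rewrite /turn /skip -!addnA /= !ptS !addn0 !det2E; ring.
Qed.

Lemma pentagram_diagram virt : diagram_of F v (Diagram (~~ c)
  [seq pentagon_passage (nseq 5 (Some (~~ c))) (volume_signs F v) virt q
  | q <- pentagram_edges]).
Proof.
pose pr (q : 'I_5 * 'I_5) : nat * nat := (val q.1, val q.2).
pose L : seq ('I_5 * 'I_5) := [seq (inord q.1, inord q.2) | q <- pentagram_edges].
have pr_inj : injective pr by move=> [i j] [k l] [/val_inj -> /val_inj ->].
have prL : map pr L = pentagram_edges by rewrite /L /pr /= !inordK.
have L_mem q : (q \in L) = meets s q.1 q.2.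
  rewrite -(mem_map pr_inj) prL meets_edges // !edges_cross_all.
  by case: q => [[[|[|[|[|[|//]]]]] hi] [[|[|[|[|[|//]]]]] hj]].
have L_first q : q \in L -> first_edge (pr q) || first_edge ((pr q).2, (pr q).1).
  by rewrite L_mem meets_edges // /pr /=; case: ifP => //= _; case: ifP.
rewrite -{1}prL -map_comp; apply: diagram_of_map => //.
- have h2 k l m : (k < 5)%N -> l = ((k + 2) %% 5)%N -> m = ((k + 3) %% 5)%N ->
      before (place F v (inord k, inord l)) (place F v (inord k, inord m)).
    move=> hk el em; have hl : (l < 5)%N by rewrite el ltn_mod.
    have hm : (m < 5)%N by rewrite em ltn_mod.
    by rewrite /before /place /= eqxx ltnn /=; apply: param_lt; rewrite /= !inordK.
  have h1 k l m n : (k < 5)%N -> (m < 5)%N -> (k < m)%N ->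
      before (place F v (inord k, inord l)) (place F v (inord m, inord n)).
    by move=> hk hm km; rewrite /before /place /= !inordK ?km.
  by rewrite /L /= !h2 ?h1.
- move=> q r qL rL; rewrite /= /pentagon_passage {1 2}/label /=.
  have e : (crossing_index (pr q) == crossing_index (pr r)) =
      (q == r) || (r == (q.2, q.1)).
    by rewrite crossing_index_eq ?ltn_ord ?L_first.
  split=> [/eqP|h].
    by rewrite [X in is_true X]e => /orP[]/eqP ->; [left | right].
  by apply/eqP; rewrite [X in is_true X]e; case: h => ->; rewrite eqxx ?orbT.
- move=> q qL /=; pose r := (q.2, q.1); rewrite -/r.
  have [X0 ec eV sX] := meets_data gp (etrans (esym (L_mem q)) qL).
  set k := crossing_index _ in ec eV sX; rewrite /= /pentagon_passage.
  have rL : r \in L by rewrite L_mem meets_sym -L_mem; case: (q) qL.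
  have ck : crossing_index (pr r) = k.
    by apply/esym/eqP; rewrite crossing_index_eq ?ltn_ord ?L_first //= eqxx orbT.
  rewrite ck -[crossing_index _]/k.
  have sk : (at5 (nseq 5 (Some (~~ c))) k == Some true) = (0 < skip F v k).
    rewrite -sgn_of_true skip_c /at5 nth_nseq ltn_mod //.
  have k5 : (k < 5)%N by rewrite /k /crossing_index; case: ifP => _; apply: ltn_ord.
  rewrite /kind /side /= sk sX at5_volume (sgn_of_height X0 eV); split=> //.
  by case: (nth true virt k); [left | right].
exists ord0; split=> //.
  have [u hu] := base; exists u => i i0; rewrite !pt_ord; apply: hu.
  by rewrite ltn_ord andbT lt0n.
rewrite cross_direction /edge_det ord_predK pt_ordS !pt_ord /=.
have -> : ((0 + 5).-1 %% 5 = 4)%N by [].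
transitivity (turn F v 4 < 0).
  by rewrite -sgn_of_false turn_c; case: (c).
rewrite /turn -[(4 + 1)%N]/(0 + 5)%N -[(4 + 2)%N]/(0 + 6)%N !ptS !det2E.
by congr (_ < 0); ring.
Qed.

End Pentagram.

(** A convex pentagon with vertices in the order of a pentagram, the base vertex
at the top.  The heights are such that two of the volumes have the sign opposite
to that of the three others, and the two are not neighbours in the order of the
crossings along the curve. *)
Definition pentagram_xs (h : bool) : seq int :=
  [seq if h then - x else x | x <- [:: 0; -2; 3; -3; 2]].
Definition pentagram_ys : seq int := [:: 3; -3; 1; 1; -3].
Definition pentagram_zs (v : bool) : seq int :=
  [seq if v then - z else z | z <- [:: 1; 1; 0; 1; 0]].

(** Integer versions of [det2] and [volume], whose signs are computed. *)
Definition int_det (h : bool) (i j k : nat) : int :=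
  let x l := nth 0 (pentagram_xs h) (l %% 5) in
  let y l := nth 0 pentagram_ys (l %% 5) in
  (x j - x i) * (y k - y i) - (y j - y i) * (x k - x i).

Definition int_volume (v h : bool) (k : nat) : int :=
  let z l := nth 0 (pentagram_zs v) (l %% 5) in
  z (k + 1)%N * int_det h k (k + 2) (k + 3)
  - z k * int_det h (k + 1) (k + 2) (k + 3)
  + z (k + 3)%N * int_det h k (k + 1) (k + 2)
  - z (k + 2)%N * int_det h k (k + 1) (k + 3).

Section IntegerPentagram.
Variables (R : realType) (v h : bool).

Definition pentagram_vertex (k : nat) : 'rV[R]_3 :=
  \row_j (nth 0 [:: nth 0 (pentagram_xs h) k; nth 0 pentagram_ys k;
                    nth 0 (pentagram_zs v) k] j)%:~R.

Definition pentagram : 5.-tuple 'rV[R]_3 := [tuple pentagram_vertex k | k < 5].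

Local Notation F := (1%:M : 'M[R]_3).

Lemma pentagram_nth k : nth 0 pentagram (k %% 5) = pentagram_vertex (k %% 5).
Proof.
have hk : (k %% 5 < 5)%N by rewrite ltn_mod.
by rewrite -[(k %% 5)%N]/(val (Ordinal hk)) -tnth_nth tnth_mktuple.
Qed.

Lemma pt_coord k j : pt F pentagram k 0 j =
  (nth 0 [:: nth 0 (pentagram_xs h) (k %% 5); nth 0 pentagram_ys (k %% 5)] j)%:~R.
Proof.
rewrite /pt (nth_map 0) ?size_tuple ?ltn_mod // pentagram_nth /proj mulmx1 !mxE.
by case: j => [[|[|]]].
Qed.

Lemma ht_coord k : ht F pentagram k = (nth 0 (pentagram_zs v) (k %% 5))%:~R.
Proof. by rewrite /ht pentagram_nth /height mulmx1 mxE. Qed.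

Lemma det2_int i j k :
  det2 (pt F pentagram i) (pt F pentagram j) (pt F pentagram k) = (int_det h i j k)%:~R.
Proof. by rewrite det2E !pt_coord /= /int_det !(rmorphB, rmorphM). Qed.

Lemma volume_int k : volume F pentagram k = (int_volume v h k)%:~R.
Proof.
by rewrite /volume /turn /skip !det2_int !ht_coord /int_volume !(rmorphB, rmorphD, rmorphM).
Qed.

Lemma sgn_of_int (z : int) (b : bool) : z != 0 -> (0 < z) = b ->
  sgn_of (z%:~R : R) = Some b.
Proof. by rewrite /sgn_of intr_eq0 ltr0z => /negbTE -> ->. Qed.

Lemma pentagram_turn k : sgn_of (turn F pentagram k) = Some (~~ h).
Proof.
rewrite -turn_mod /turn det2_int; move: (k %% 5)%N (ltn_mod k 5) => {}k.
by case: k => [|[|[|[|[|//]]]]] _; case: h; apply: sgn_of_int.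
Qed.

Lemma pentagram_skip k : sgn_of (skip F pentagram k) = Some h.
Proof.
rewrite -skip_mod /skip det2_int; move: (k %% 5)%N (ltn_mod k 5) => {}k.
by case: k => [|[|[|[|[|//]]]]] _; case: h; apply: sgn_of_int.
Qed.

Definition pentagram_volume_signs : seq sgn :=
  [seq Some (b (+) v (+) h) | b <- [:: false; false; true; true; false]].

Lemma pentagram_volume_signsE : volume_signs F pentagram = pentagram_volume_signs.
Proof.
rewrite /volume_signs /= !volume_int /pentagram_volume_signs /=.
by congr [:: _; _; _; _; _]; apply: sgn_of_int; case: v h => [] [].
Qed.

Lemma pentagram_noncollinear (i j k : 'I_5) : uniq [:: i; j; k] ->
  det2 (tnth (shadow F pentagram) i) (tnth (shadow F pentagram) j)
    (tnth (shadow F pentagram) k) != 0.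
Proof.
rewrite !pt_ord det2_int intr_eq0 -(map_inj_uniq val_inj) /=.
have : all (fun i => all (fun j => all (fun k => uniq [:: i; j; k] ==> (int_det h i j k != 0))
    (iota 0 5)) (iota 0 5)) (iota 0 5) by case: h.
have hm (l : 'I_5) : val l \in iota 0 5 by rewrite mem_iota /= ltn_ord.
by move=> /allP/(_ _ (hm i))/allP/(_ _ (hm j))/allP/(_ _ (hm k))/implyP.
Qed.

Lemma pentagram_pl_polygon : pl_polygon pentagram.
Proof.
apply: (noncollinear_pl_polygon pentagram_noncollinear) => k hk.
rewrite volume_int intr_eq0; case: k hk => [|[|[|[|[|//]]]]] _; case: v h => [] []; by [].
Qed.

Lemma pentagram_realizable virt K :
  virtually_equivalent
    (Diagram h [seq pentagon_passage (nseq 5 (Some h)) pentagram_volume_signs virt q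
               | q <- pentagram_edges]) K ->
  realizable R 5 K.
Proof.
move=> e; exists pentagram, F, 0%N; eexists; split; last exact: e.
- exact: pentagram_pl_polygon.
- by split; rewrite ?det1 // trmx1 mulmx1.
- exact: noncollinear_general_position pentagram_noncollinear.
rewrite (_ : [tuple of rot 0 pentagram] = pentagram); last first.
  by apply: val_inj; rewrite /= rot0.
have := @pentagram_diagram R F pentagram (~~ h) _ pentagram_turn _ _ virt.
rewrite negbK pentagram_volume_signsE; apply.
- exact: noncollinear_general_position pentagram_noncollinear.
- exact: pentagram_skip.
exists (\row_j (j == 1)%:R) => k hk.
have dotE (q : 'rV[R]_2) : dot (\row_j (j == 1)%:R) q = q 0 1.
  rewrite /dot !big_ord_recl big_ord0 !mxE /= mul0r mul1r add0r addr0.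
  by congr (q 0 _); apply: val_inj.
rewrite !dotE !pt_coord ltr_int.
by case: k hk => [|[|[|[|[|//]]]]].
Qed.
End IntegerPentagram.

Lemma unknots_equivalent o o' : virtually_equivalent (unknot o) (unknot o').
Proof.
have flip b : virtually_equivalent (unknot b) (unknot (~~ b)).
  by apply: equivalent_move; [apply: plane_unknot.. | apply: (reverse b [::])].
by case: o o' => [] []; [apply: rst_refl|apply: flip|apply: flip|apply: rst_refl].
Qed.

Definition pentagram_code (v h : bool) (virt : seq bool) : diagram :=
  Diagram h [seq pentagon_passage (nseq 5 (Some h)) (pentagram_volume_signs v h) virt q
            | q <- pentagram_edges].

(** The crossings to declare virtual: the real ones are the two consecutive
crossings of equal sign for 2.1, together with the third crossing of that sign
for 3.5. *)
Definition knot_choices : seq (diagram * seq bool) :=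
  [:: (knot_2_1, [:: true; false; true; true; false]);
      (knot_3_5, [:: false; false; true; true; false])].

Definition realizes (v h : bool) (virt : seq bool) (Ms : seq diagram) : bool :=
  if planeb (pentagram_code v h virt) then reduces_to Ms (pentagram_code v h virt)
  else false.

Definition choices_ok : bool :=
  all (fun vh => if realizes vh.1 vh.2 (nseq 5 true) unknots then
      all (fun Mm => realizes vh.1 vh.2 Mm.2 [:: mirror vh.1 vh.2 Mm.1]) knot_choices
    else false) [:: (false, false); (false, true); (true, false); (true, true)].

Lemma realizes_sound v h virt Ms : {in Ms, forall M, plane_diagram M} ->
  realizes v h virt Ms ->
  exists2 M, M \in Ms & virtually_equivalent (pentagram_code v h virt) M.
Proof.
by move=> pMs; rewrite /realizes; case: ifP => // /planeb_sound pD; apply: reduces_to_sound.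
Qed.

Lemma choices_okT : choices_ok. Proof. by vm_compute. Qed.

Lemma form_realizable (R : realType) (K : diagram) : plane_diagram K ->
     up_to_mirror_images
       (fun M => [\/ is_unknot M, virtually_equivalent M knot_2_1
                   | virtually_equivalent M knot_3_5]) K ->
     exists2 n : nat, (n <= 5)%N & realizable R n K.
Proof.
move=> pK /up_to_mirrorP[v [h hK]]; exists 5%N => //.
have vh_in : (v, h) \in [:: (false, false); (false, true); (true, false); (true, true)].
  by case: (v); case: (h).
have := allP choices_okT _ vh_in; case: ifP => // ru ok.
have via M virt : (M, virt) \in knot_choices -> plane_diagram M ->
    virtually_equivalent (mirror v h K) M -> realizable R 5 K.
  move=> hM pM e; apply: (@pentagram_realizable R v h virt).
  have [|N] := realizes_sound _ (allP ok _ hM).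
    by move=> N; rewrite inE => /eqP->; apply: plane_mirror.
  rewrite inE => /eqP-> eN; apply: rst_trans eN _; apply: rst_sym.
  by have := equivalent_mirror v h e; rewrite mirrorK.
case: hK => [[o eo]|e|e].
- apply: (@pentagram_realizable R v h (nseq 5 true)).
  have [N Nu eN] := realizes_sound plane_unknots ru.
  have := equivalent_mirror v h eo; rewrite mirrorK /mirror /= => eK.
  apply: rst_trans eN _; apply: rst_sym; apply: rst_trans eK _.
  by move: Nu; rewrite !inE => /orP[]/eqP->; apply: unknots_equivalent.
- exact: (via knot_2_1 [:: true; false; true; true; false] isT plane_diagram_2_1 e).
- exact: (via knot_3_5 [:: false; false; true; true; false] isT plane_diagram_3_5 e).
Qed.

Local Close Scope ring_scope.

Theorem theorem3p3 (R : realType) :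
  (forall K : diagram, plane_diagram K ->
     (exists2 n : nat, n <= 5 & realizable R n K) ->
     up_to_mirror_images
       (fun M => [\/ is_unknot M, virtually_equivalent M knot_2_1,
                     virtually_equivalent M knot_3_5
                   | virtually_equivalent M knot_3_7]) K) /\
  (forall K : diagram, plane_diagram K ->
     up_to_mirror_images
       (fun M => [\/ is_unknot M, virtually_equivalent M knot_2_1
                   | virtually_equivalent M knot_3_5]) K ->
     exists2 n : nat, n <= 5 & realizable R n K).
Proof. by split=> K pK; [apply: realizable_form | apply: form_realizable]. Qed.
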